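(* Let $T=(T_1,\ldots,T_n)\in B(\mathcal H)^n$ be a quasi-nilpotent $n$-tuple of operators. Then there exist a quasi-nilpotent weighted left multi-shift $W=(W_1,\ldots,W_n)$ of compact operators and a joint invariant (closed) subspace $\mathcal M\subset F^2(H_n)\otimes\mathcal H$ under the operators $W_i^*\otimes I_{\mathcal H}$, $i\in\{1,\ldots,n\}$, such that $(T_1,\ldots,T_n)$ is jointly similar to $$(P_{\mathcal M}(W_1\otimes I_{\mathcal H})|_{\mathcal M},\ldots,P_{\mathcal M}(W_n\otimes I_{\mathcal H})|_{\mathcal M}).$$
   Context: Let $n\ge 1$ and let $\mathbb F_n^+$ be the unital free semigroup on generators $g_1,\ldots,g_n$ with identity $g_0$; $|\alpha|$ is the length of $\alpha$. $F^2(H_n)$ is the full Fock space, a Hilbert space with orthonormal basis $\{e_\alpha\}_{\alpha\in\mathbb F_n^+}$. For operators $T_1,\ldots,T_n$, $T_\alpha:=T_{i_1}\cdots T_{i_k}$ if $\alpha=g_{i_1}\cdots g_{i_k}$, $T_{g_0}:=I$. A weighted left multi-shift is an $n$-tuple of operators on $F^2(H_n)$ of the form $W_ie_\alpha=\mu_{g_i\alpha}e_{g_i\alpha}$ with weights $\mu_\beta\ge0$ ($|\beta|\ge1$) and $\sup_\alpha\mu_{g_i\alpha}<\infty$ for each $i$. The joint spectral radius is $r(T):=\lim_{k\to\infty}\|\sum_{|\alpha|=k}T_\alpha T_\alpha^*\|^{1/2k}$; $T$ is quasi-nilpotent if $r(T)=0$. $T\in B(\mathcal H)^n$ is jointly similar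 to $A\in B(\mathcal K)^n$ if there is an invertible $X:\mathcal H\to\mathcal K$ with $T_i=X^{-1}A_iX$ for all $i$. $P_{\mathcal M}$ is the orthogonal projection onto $\mathcal M$. *)

(* Defs.v *)
From HB Require Import structures.
From mathcomp Require Import all_boot all_order all_algebra.
From mathcomp Require Import all_classical all_reals all_analysis.
From mathcomp Require Import complex.

Set Implicit Arguments.
Unset Strict Implicit.
Unset Printing Implicit Defensive.

Import Order.TTheory GRing.Theory Num.Theory numFieldNormedType.Exports.

Local Open Scope classical_set_scope.
Local Open Scope ring_scope.
Local Open Scope complex_scope.

(* The inner product is linear in its first argument. *)
HB.mixin Record CompleteNormedModule_isHilbert (R : realType) V
    of CompleteNormedModule R[i] V := {
  dotp : V -> V -> R[i];
  dotp_linearl : forall z, linear (dotp^~ z : V -> R[i]^o);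
  dotpC : forall x y, dotp y x = (dotp x y)^* ;
  dotp_norm : forall x, dotp x x = `|x| ^+ 2 }.

#[short(type="hilbertType")]
HB.structure Definition Hilbert (R : realType) :=
  { V of CompleteNormedModule R[i] V & CompleteNormedModule_isHilbert R V }.

Record closedSubspace (R : realType) (H : hilbertType R) := ClosedSubspace {
  subspace_pred :> {pred H};
  subspace_submod : submod_closed subspace_pred;
  subspace_closed : closed [set` subspace_pred] }.

HB.instance Definition _ (R : realType) (H : hilbertType R)
    (M : closedSubspace H) :=
  GRing.isSubmodClosed.Build R[i] H (subspace_pred M) (subspace_submod M).

Section SubspaceHilbert.
Context (R : realType) (H : hilbertType R) (M : closedSubspace H).

Record subspace_of := SubspaceElt {
  subspace_val : H;
  subspace_valP : subspace_val \in subspace_pred M }.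

HB.instance Definition _ := [isSub for subspace_val].
HB.instance Definition _ := [Choice of subspace_of by <:].
HB.instance Definition _ := [SubChoice_isSubLmodule of subspace_of by <:].

Let norm (x : subspace_of) : R[i] := `|val x|.

Let ler_normD x y : norm (x + y) <= norm x + norm y.
Proof. exact: ler_normD. Qed.
Let normrZ (l : R[i]) x : norm (l *: x) = `|l| * norm x.
Proof. exact: normrZ. Qed.
Let normr0_eq0 x : norm x = 0 -> x = 0.
Proof. by move=> /normr0_eq0 x0; apply: val_inj. Qed.

HB.instance Definition _ :=
  Lmodule_isNormed.Build R[i] subspace_of ler_normD normrZ normr0_eq0.

Let complete (F : set_system subspace_of) :
  ProperFilter F -> cauchy F -> cvg F.
Proof.
move=> PF /cauchyP cF.
have : cvg (val @ F).
  pose PG := fmap_proper_filter val PF.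
  apply: (@cauchy_cvg H (val @ F) PG).
  apply: (cauchyP (val @ F)).2 => e e0.
  by have [x Fx] := cF e e0; exists (val x); rewrite -ball_normE.
move=> /cvg_ex[l Fl].
have Ml : [set` subspace_pred M] l.
  apply: (@closed_cvg _ _ F _ val _ (@subspace_closed _ _ M) _ l Fl).
  by apply: filterE => x; exact: subspace_valP.
apply/cvg_ex; exists (SubspaceElt Ml).
apply/cvgrPdist_lt => e e0.
by move/cvgrPdist_lt: Fl => /(_ e e0).
Qed.

HB.instance Definition _ := Uniform_isComplete.Build subspace_of complete.

Let dot (x y : subspace_of) : R[i] := dotp (val x) (val y).

Let dot_linearl z : linear (dot^~ z : subspace_of -> R[i]^o).
Proof. by move=> a x y; exact: (dotp_linearl (val z)). Qed.
Let dotC x y : dot y x = (dot x y)^*.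
Proof. exact: dotpC. Qed.
Let dot_norm x : dot x x = `|x| ^+ 2.
Proof. exact: dotp_norm. Qed.

HB.instance Definition _ := CompleteNormedModule_isHilbert.Build R subspace_of
  dot_linearl dotC dot_norm.

End SubspaceHilbert.
Section Operators.
Context (R : realType).
Implicit Types H K : hilbertType R.

Definition bounded_op H K (f : H -> K) : Prop :=
  linear f /\ exists C : R[i], forall x, `|f x| <= C * `|x|.

(* Norms take values in R[i]; they are real, so Re loses nothing. *)
Definition op_norm H K (f : H -> K) : R :=
  sup [set complex.Re `|f x| | x in [set x : H | `|x| <= 1]].

Definition compact_op H K (f : H -> K) : Prop :=
  bounded_op f /\ precompact (f @` [set x : H | `|x| <= 1]).

(* By the Riesz representation theorem there is exactly one such z when f is
   bounded. *)
Definition adjoint H K (f : H -> K) (y : K) : H :=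
  xget 0 [set z | forall x, dotp (f x) y = dotp x z].

(* By the projection theorem there is exactly one such m. *)
Definition orth_proj H (M : closedSubspace H) (x : H) : subspace_of M :=
  xget 0 [set m | forall y : subspace_of M, dotp (x - val m) (val y) = 0].

Definition compression H (M : closedSubspace H) (f : H -> H) :
  subspace_of M -> subspace_of M := fun x => orth_proj M (f (val x)).

Definition invariant_subspace H (M : closedSubspace H) (f : H -> H) : Prop :=
  forall x, x \in subspace_pred M -> f x \in subspace_pred M.

Definition lin_span H (A : set H) : set H :=
  [set x | exists k (c : 'I_k -> R[i]) (v : 'I_k -> H),
    (forall j, A (v j)) /\ x = \sum_j c j *: v j].

Definition orthonormal_basis H (I : eqType) (e : I -> H) : Prop :=
  (forall i j, dotp (e i) (e j) = (i == j)%:R) /\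
  closure (lin_span (range e)) = setT.

(* The Hilbert space tensor product, which is determined up to a unique unitary
   operator compatible with the elementary tensors. *)
Record hilbertTensor H K := HilbertTensor {
  tensor_space :> hilbertType R;
  tensor : H -> K -> tensor_space;
  tensor_linearl : forall y, linear (tensor^~ y);
  tensor_linearr : forall x, linear (tensor x);
  tensor_dotp : forall x x' y y',
    dotp (tensor x y) (tensor x' y') = dotp x x' * dotp y y';
  tensor_total :
    closure (lin_span [set z | exists x y, z = tensor x y]) = setT }.

(* For bounded f and g there is exactly one such operator. *)
Definition tensor_op H K (HK : hilbertTensor H K) (f : H -> H) (g : K -> K) :
    HK -> HK :=
  xget (fun=> 0) [set h : HK -> HK | bounded_op h /\
    forall x y, h (tensor HK x y) = tensor HK (f x) (g y)].

(* The full Fock space; the word g_{i_1} ... g_{i_k} of the free semigroup is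
   the list [:: i_1; ...; i_k]. *)
Record fockSpace (n : nat) := FockSpace {
  fock_space :> hilbertType R;
  fock_basis : seq 'I_n -> fock_space;
  fock_basisP : orthonormal_basis fock_basis }.

Section Tuples.
Context (n : nat).

Definition word_op H (T : 'I_n -> H -> H) (a : seq 'I_n) : H -> H :=
  foldr (fun i f => T i \o f) id a.

Definition joint_spectral_seq H (T : 'I_n -> H -> H) (k : nat) : R :=
  op_norm (fun x : H =>
    \sum_(a : k.-tuple 'I_n) word_op T a (adjoint (word_op T a) x))
  `^ ((2 * k)%:R^-1).

Definition joint_spectral_radius_is H (T : 'I_n -> H -> H) (r : R) : Prop :=
  joint_spectral_seq T @ \oo --> r.

Definition quasi_nilpotent H (T : 'I_n -> H -> H) : Prop :=
  joint_spectral_radius_is T 0.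

(* The value of mu at the empty word is irrelevant. *)
Definition weighted_left_multishift (F : fockSpace n) (W : 'I_n -> F -> F) :
    Prop :=
  (forall i, bounded_op (W i)) /\
  exists mu : seq 'I_n -> R,
    [/\ forall b, (1 <= size b)%N -> 0 <= mu b,
        forall i, has_ubound (range (fun a => mu (i :: a)))
      & forall i a, W i (fock_basis F a) =
                    (mu (i :: a))%:C *: fock_basis F (i :: a)].

Definition jointly_similar H K (T : 'I_n -> H -> H) (A : 'I_n -> K -> K) :
    Prop :=
  exists (X : H -> K) (Y : K -> H),
    [/\ bounded_op X, bounded_op Y, cancel X Y, cancel Y X
      & forall i x, T i x = Y (A i (X x))].

End Tuples.
End Operators.

Arguments compression {R H} M f.
Arguments tensor_op {R H K} HK f g.

(* Main.v *)
(** Rota's model for a row operator. Choose weights m_k decreasing to 0 with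
    2 r_j <= m_k for all j >= k, where r_k is the k-th term of the joint
    spectral sequence of T, let W be the multi-shift with weight m_|b| at the
    word b, and put lam_k = m_1 ... m_k. Since ||sum_(|a|=k) T_a T_a^*|| is at
    most (2^-k lam_k)^2 for k >= 1, there is a bounded operator L from the tensor product
    to H with L (e_a (x) h) = lam_|a|^-1 T_a h. It satisfies
    L (W_i (x) I) = T_i L and L (e_[] (x) h) = h, so L is onto, and its kernel
    is invariant under every W_i (x) I. Hence M := (ker L)^orth is invariant
    under the adjoints, and L restricts to an isomorphism from M onto H that
    intertwines the compressions of the W_i (x) I with the T_i; its inverse is
    h |-> P_M (e_[] (x) h). *)

Require Import Defs.
From HB Require Import structures.
From mathcomp Require Import all_boot all_order all_algebra.
From mathcomp Require Import all_classical all_reals all_analysis.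
From mathcomp Require Import complex.
From mathcomp Require Import ring lra.

Set Implicit Arguments.
Unset Strict Implicit.
Unset Printing Implicit Defensive.

Import Order.TTheory GRing.Theory Num.Theory numFieldNormedType.Exports.

Local Open Scope classical_set_scope.
Local Open Scope ring_scope.
Local Open Scope complex_scope.

(** * Real-valued norms *)

(** The factor 2 in the choice of the weights pays for a triangle inequality. The images in [H] of
    words of different lengths need not be orthogonal, so the contributions of the lengths can only
    be added in norm. Since r_k <= m_k / 2 <= m_j / 2 for 1 <= j <= k, multiplying over j gives
    r_k^k <= 2^-k lam_k, and the contributions are dominated by a geometric series. Monotonicity of
    the weights is used again for W: it puts the largest weight product of W_a at the empty word, so
    the spectral sequence of W is bounded by the geometric means of m_1, ..., m_k; and it bounds the
    part of W_i of length above k by m_k, which gives compactness. Strict positivity makes lam_k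
    invertible. [adjoint], [orth_proj] and [tensor_op] are [xget] choices, so nothing is known about
    them before a solution of their defining property has been exhibited. This is the source of the
    projection theorem, the Riesz theorem and the extension by density below. *)

Section RealNorm.
Context {R : realType} {V : normedZmodType R[i]}.
Implicit Types x y : V.

Definition rnorm (x : V) : R := complex.Re `|x|.

Lemma normE x : `|x| = (rnorm x)%:C.
Proof. by rewrite /rnorm RRe_real // normr_real. Qed.

Lemma rnorm_ge0 x : 0 <= rnorm x.
Proof. by rewrite -lecR -normE normr_ge0. Qed.

Lemma rnorm0 : rnorm 0 = 0.
Proof. by rewrite /rnorm normr0. Qed.

Lemma rnorm0_eq0 x : rnorm x = 0 -> x = 0.
Proof. by move=> x0; apply: normr0_eq0; rewrite normE x0. Qed.

Lemma rnorm_gt0 x : x != 0 -> 0 < rnorm x.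
Proof.
move=> x0; rewrite lt_neqAle rnorm_ge0 andbT eq_sym.
by apply: contra x0 => /eqP/rnorm0_eq0 ->.
Qed.

Lemma rnorm_small x : (forall e : R, 0 < e -> rnorm x <= e) -> x = 0.
Proof.
move=> xe; apply: rnorm0_eq0; apply/eqP; rewrite eq_le rnorm_ge0 andbT.
by apply/ler_addgt0Pl => e e0; rewrite addr0 xe.
Qed.

Lemma rnormD x y : rnorm (x + y) <= rnorm x + rnorm y.
Proof. by rewrite -lecR rmorphD /= -!normE ler_normD. Qed.

Lemma rnormN x : rnorm (- x) = rnorm x.
Proof. by rewrite /rnorm normrN. Qed.

Lemma rnorm_sum I (r : seq I) (P : pred I) (f : I -> V) :
  rnorm (\sum_(i <- r | P i) f i) <= \sum_(i <- r | P i) rnorm (f i).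
Proof.
elim/big_ind2: _ => [|x a y b xa yb|//]; first by rewrite rnorm0.
exact: le_trans (rnormD _ _) (lerD xa yb).
Qed.

End RealNorm.

Section RealNormMod.
Context {R : realType} {V : normedModType R[i]}.
Implicit Types x y : V.

Lemma rnormZ (a : R[i]) x : rnorm (a *: x) = rnorm a * rnorm x.
Proof. by apply: complexI; rewrite rmorphM /= -!normE normrZ. Qed.

Lemma rnorm_real (a : R) : rnorm (a%:C : R[i]) = `|a|.
Proof.
by apply: complexI; rewrite -normE normc_def /= expr0n addr0 sqrtr_sqr.
Qed.

Lemma rnormZr (a : R) x : 0 <= a -> rnorm (a%:C *: x) = a * rnorm x.
Proof. by move=> a0; rewrite rnormZ rnorm_real ger0_norm. Qed.

Lemma rnormM (a b : R[i]) : rnorm (a * b) = rnorm a * rnorm b.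
Proof. by apply: complexI; rewrite rmorphM /= -!normE normrM. Qed.

Lemma conjcM (a b : R[i]) : (a * b)^*%C = a^*%C * b^*%C.
Proof. exact: rmorphM. Qed.

Lemma mulrJ (a : R[i]) : a * a^*%C = (rnorm a ^+ 2)%:C.
Proof. by rewrite -sqr_normc normE rmorphXn. Qed.

Lemma rnorm_ge_Re (a : R[i]) : complex.Re a <= rnorm a.
Proof. by rewrite (le_trans (ler_norm _)) // -lecR -normE normc_ge_Re. Qed.

Lemma closureP_norm (A : set V) x :
  closure A x <-> forall e : R, 0 < e -> exists2 y, A y & rnorm (x - y) < e.
Proof.
split=> [cA e e0|cA B].
  have e0' : (0 : R[i]) < e%:C by rewrite ltcR.
  have [y [Ay]] := cA _ (nbhsx_ballx x _ e0').
  by rewrite -ball_normE /ball_ /= normE ltcR; exists y.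
rewrite -nbhs_ballE => -[e /= e0 xB].
(* A positive element of [R[i]] is real, so the balls of a complex normed module have real radii. *)
have eE : e = (complex.Re e)%:C by rewrite RRe_real // realE ltW.
rewrite eE ltcR in e0.
have [y Ay xy] := cA _ e0.
by exists y; split=> //; apply: xB; rewrite -ball_normE /ball_ /= normE eE ltcR.
Qed.

Lemma closedP_norm (A : set V) :
  closed A <-> forall x, (forall e : R, 0 < e -> exists2 y, A y & rnorm (x - y) < e) -> A x.
Proof.
split=> [cA x xA|cA x]; first by apply: cA; apply/closureP_norm.
by move/closureP_norm/cA.
Qed.

End RealNormMod.

Lemma cauchy_rnorm_cvg {R : realType} {V : completeNormedModType R[i]} (u : nat -> V) :
  (forall e : R, 0 < e -> exists N, forall j k,
    (N <= j)%N -> (N <= k)%N -> rnorm (u j - u k) < e) ->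
  exists l, forall e : R, 0 < e -> exists N, forall k, (N <= k)%N -> rnorm (l - u k) < e.
Proof.
move=> cu.
have : cvg (u @ \oo).
  apply: cauchy_cvg; apply: (cauchyP (u @ \oo)).2 => e e0.
  have eE : e = (complex.Re e)%:C by rewrite RRe_real // realE ltW.
  rewrite eE ltcR in e0.
  have [N uN] := cu _ e0; exists (u N); rewrite -ball_normE.
  by exists N => // k /= Nk; rewrite normE eE ltcR uN.
move=> /cvg_ex[l ul]; exists l => e e0.
have e0' : (0 : R[i]) < e%:C by rewrite ltcR.
move/cvgrPdist_lt: ul => /(_ _ e0')[N _ uN]; exists N => k /uN.
by rewrite /= normE ltcR.
Qed.

(** * Inner products and bounded operators *)

Section InnerProduct.
Context {R : realType} {H : hilbertType R}.
Implicit Types (x y z : H) (a : R[i]).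

Lemma dotpDl x y z : dotp (x + y) z = dotp x z + dotp y z.
Proof. by have := dotp_linearl z 1 x y; rewrite !scale1r. Qed.

Lemma dotp0l z : dotp 0 z = 0.
Proof. by apply: (addrI (dotp 0 z)); rewrite -dotpDl !addr0. Qed.

Lemma dotpZl a x z : dotp (a *: x) z = a * dotp x z.
Proof. by have := dotp_linearl z a x 0; rewrite dotp0l !addr0. Qed.

Lemma dotpNl x z : dotp (- x) z = - dotp x z.
Proof. by rewrite -scaleN1r dotpZl mulN1r. Qed.

Lemma dotpBl x y z : dotp (x - y) z = dotp x z - dotp y z.
Proof. by rewrite dotpDl dotpNl. Qed.

Lemma dotpDr x y z : dotp z (x + y) = dotp z x + dotp z y.
Proof. by rewrite dotpC dotpDl rmorphD /= -!dotpC. Qed.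

Lemma dotp0r z : dotp z 0 = 0.
Proof. by rewrite dotpC dotp0l conjc0. Qed.

Lemma dotpZr a x z : dotp z (a *: x) = a^*%C * dotp z x.
Proof. by rewrite dotpC dotpZl rmorphM /= -dotpC. Qed.

Lemma dotpNr x z : dotp z (- x) = - dotp z x.
Proof. by rewrite dotpC dotpNl rmorphN /= -dotpC. Qed.

Lemma dotpBr x y z : dotp z (x - y) = dotp z x - dotp z y.
Proof. by rewrite dotpDr dotpNr. Qed.

Lemma dotp_suml I (r : seq I) (P : pred I) (f : I -> H) z :
  dotp (\sum_(i <- r | P i) f i) z = \sum_(i <- r | P i) dotp (f i) z.
Proof. exact: (big_morph (dotp^~ z) (fun x y => dotpDl x y z) (dotp0l z)). Qed.

Lemma dotp_sumr I (r : seq I) (P : pred I) (f : I -> H) z :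
  dotp z (\sum_(i <- r | P i) f i) = \sum_(i <- r | P i) dotp z (f i).
Proof. exact: (big_morph (dotp z) (fun x y => dotpDr x y z) (dotp0r z)). Qed.

Lemma dotpxx x : dotp x x = (rnorm x ^+ 2)%:C.
Proof. by rewrite dotp_norm normE rmorphXn. Qed.

Lemma dotpxx_eq0 x : dotp x x = 0 -> x = 0.
Proof.
by rewrite dotp_norm => /eqP; rewrite expf_eq0 /= normr_eq0 => /eqP.
Qed.

Lemma cauchy_schwarz x y : rnorm (dotp x y) <= rnorm x * rnorm y.
Proof.
have [->|y0] := eqVneq y 0; first by rewrite dotp0r !rnorm0 mulr0.
have ny : 0 < rnorm y by exact: rnorm_gt0.
set a := dotp x y; set t := rnorm y ^+ 2.
have t0 : 0 < t by rewrite exprn_gt0.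
(* This vector is [t] times the component of [x] orthogonal to [y]; scaling by [t] avoids a
   division. *)
have := dotpxx (t%:C *: x - a *: y).
rewrite !(dotpBl, dotpBr, dotpZl, dotpZr) !dotpxx (dotpC x y) -/a -/t !conjc_real.
have -> : t%:C * (t%:C * (rnorm x ^+ 2)%:C - a^*%C * a) -
  a * (t%:C * a^*%C - a^*%C * t%:C) =
   t%:C * t%:C * (rnorm x ^+ 2)%:C - t%:C * (a * a^*%C) by ring.
rewrite mulrJ -!rmorphM -rmorphB /= => /complexI tE.
have : 0 <= t * (t * rnorm x ^+ 2 - rnorm a ^+ 2).
  by rewrite mulrBr mulrA tE sqr_ge0.
rewrite pmulr_rge0 // subr_ge0 /t -exprMn mulrC.
by rewrite ler_pXn2r // nnegrE ?mulr_ge0 ?rnorm_ge0.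
Qed.

Lemma sqr_rnormD x y :
  rnorm (x + y) ^+ 2 = rnorm x ^+ 2 + rnorm y ^+ 2 + 2 * complex.Re (dotp x y).
Proof.
have re2 (r : R) : (2 * r)%:C = 2 * r%:C by rewrite rmorphM rmorph_nat.
apply: complexI; rewrite 2!raddfD /= re2 -addcJ -!dotpxx dotpDl !dotpDr (dotpC x y).
by ring.
Qed.

Lemma sqr_rnormB x y :
  rnorm (x - y) ^+ 2 = rnorm x ^+ 2 + rnorm y ^+ 2 - 2 * complex.Re (dotp x y).
Proof. by rewrite sqr_rnormD rnormN dotpNr /= raddfN /= mulrN. Qed.

Lemma pythagoras (I : eqType) (s : seq I) (f : I -> H) :
  uniq s -> (forall i j, i != j -> dotp (f i) (f j) = 0) ->
  rnorm (\sum_(i <- s) f i) ^+ 2 = \sum_(i <- s) rnorm (f i) ^+ 2.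
Proof.
move=> us of_; elim: s us => [|i s IH] /=; first by rewrite !big_nil rnorm0 expr0n.
move=> /andP[si us]; rewrite !big_cons sqr_rnormD IH // dotp_sumr.
suff -> : \sum_(j <- s) dotp (f i) (f j) = 0 by rewrite mulr0 addr0.
rewrite big_seq big1 // => j js.
by apply: of_; apply: contraNneq si => ->.
Qed.

Lemma dotp_inj_total (A : set H) x :
  closure (lin_span A) = setT -> (forall y, A y -> dotp x y = 0) -> x = 0.
Proof.
move=> totA xA; apply: dotpxx_eq0.
have xS y : lin_span A y -> dotp x y = 0.
  by case=> k [c [v [Av ->]]]; rewrite dotp_sumr big1 // => j _; rewrite dotpZr xA ?mulr0.
apply: rnorm0_eq0; apply/eqP; rewrite eq_le rnorm_ge0 andbT.
apply/ler_addgt0Pl => e e0; rewrite addr0.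
have d0 : 0 < e / (rnorm x + 1).
  by rewrite divr_gt0 // ltr_wpDl ?rnorm_ge0.
have /closureP_norm/(_ _ d0)[y Sy] : closure (lin_span A) x by rewrite totA.
have -> : dotp x x = dotp x (x - y) by rewrite dotpBr (xS y) ?subr0.
move=> xy; apply: le_trans (cauchy_schwarz _ _) _.
rewrite ltr_pdivlMr ?ltr_wpDl ?rnorm_ge0 // in xy.
apply: le_trans _ (ltW xy); rewrite mulrC ler_wpM2l ?rnorm_ge0 //.
by rewrite lerDl.
Qed.

End InnerProduct.

Section BoundedOperators.
Context {R : realType}.
Implicit Types H K : hilbertType R.

Lemma bounded_opP H K (f : H -> K) :
  bounded_op f <-> linear f /\ exists2 C : R, 0 <= C & forall x, rnorm (f x) <= C * rnorm x.
Proof.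
split=> -[lf [C]]; last first.
  by move=> C0 fC; split=> //; exists C%:C => x; rewrite !normE -rmorphM lecR fC.
move=> fC; split=> //; exists (rnorm C); first exact: rnorm_ge0.
move=> x; rewrite -lecR rmorphM /= -!normE (le_trans (fC x)) //.
have [->|x0] := eqVneq x 0; first by rewrite normr0 !mulr0.
(* Order in [R[i]] compares only elements with equal imaginary parts, so a nonzero [x] forces [C] to
   be real. On a zero space [C] may be any complex number, whence the constant [rnorm C]. *)
have CR : C \is Num.real.
  have x0' : 0 < `|x| by rewrite normr_gt0.
  rewrite realE -(pmulr_lge0 _ x0') (le_trans _ (fC x)) //.
by rewrite ler_wpM2r // real_ler_norm.
Qed.

Section Linear.
Context {U V : lmodType R[i]} (f : U -> V) (lf : linear f).

Lemma linD x y : f (x + y) = f x + f y.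
Proof. by have := lf 1 x y; rewrite !scale1r. Qed.

Lemma lin0 : f 0 = 0.
Proof. by apply: (addrI (f 0)); rewrite -linD !addr0. Qed.

Lemma linZ a x : f (a *: x) = a *: f x.
Proof. by have := lf a x 0; rewrite lin0 !addr0. Qed.

Lemma linN x : f (- x) = - f x.
Proof. by rewrite -scaleN1r linZ scaleN1r. Qed.

Lemma linB x y : f (x - y) = f x - f y.
Proof. by rewrite linD linN. Qed.

Lemma lin_sum I (r : seq I) (P : pred I) (v : I -> U) :
  f (\sum_(i <- r | P i) v i) = \sum_(i <- r | P i) f (v i).
Proof. exact: (big_morph f linD lin0). Qed.

End Linear.

End BoundedOperators.

(** * Orthogonal projections, Riesz representation and adjoints *)

Section Projection.
Context {R : realType} {H : hilbertType R}.
Implicit Types x y z : H.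

Lemma parallelogram x y :
  rnorm (x + y) ^+ 2 + rnorm (x - y) ^+ 2 = 2 * rnorm x ^+ 2 + 2 * rnorm y ^+ 2.
Proof. by rewrite sqr_rnormD sqr_rnormB; ring. Qed.

Lemma exists_natSinv_lt (e : R) : 0 < e ->
  exists N, forall k, (N <= k)%N -> k.+1%:R^-1 < e.
Proof.
move=> e0; have [N _ Ne] := near_infty_natSinv_lt (PosNum e0).
by exists N => k Nk; exact: Ne.
Qed.

Lemma orth_proj_exists (M : closedSubspace H) x :
  exists m : subspace_of M, forall y : subspace_of M, dotp (x - val m) (val y) = 0.
Proof.
pose S := [set rnorm (x - m) ^+ 2 | m in [set` subspace_pred M]].
have M0 : 0 \in subspace_pred M by exact: (subspace_submod M).1.
have MP a y z : y \in subspace_pred M -> z \in subspace_pred M ->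
    a *: y + z \in subspace_pred M by exact: (subspace_submod M).2.
have infS : has_inf S.
  split; first by exists (rnorm (x - 0) ^+ 2), 0.
  by exists 0 => _ [m _ <-]; rewrite sqr_ge0.
have dS m : m \in subspace_pred M -> inf S <= rnorm (x - m) ^+ 2.
  by move=> Mm; apply: ge_inf; [case: infS | exists m].
have /choice[u uP] (k : nat) : exists m, m \in subspace_pred M /\
    rnorm (x - m) ^+ 2 < inf S + k.+1%:R^-1.
  have k0 : 0 < k.+1%:R^-1 :> R by rewrite invr_gt0.
  have [_ [m Mm <-] mk] := inf_adherent k0 infS.
  by exists m.
have arith (a b c d p q e : R) : d <= a -> b < d + p -> c < d + q ->
    2 ^+ 2 * a + e = 2 * b + 2 * c -> e < 2 * (p + q) by move=> *; lra.
have arith2 (a p q c : R) : a < 2 * (p + q) -> p < c / 4 -> q < c / 4 -> a < c.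
  by move=> *; lra.
(* The midpoint of [u j] and [u k] lies in [M], so its distance to [x] is no smaller than the
   infimum; the parallelogram law turns this into a Cauchy estimate. *)
have uu j k : rnorm (u j - u k) ^+ 2 < 2 * (j.+1%:R^-1 + k.+1%:R^-1).
  have := parallelogram (x - u j) (x - u k).
  have -> : x - u j - (x - u k) = - (u j - u k) by rewrite opprB addrC addrA subrK opprB.
  have -> : x - u j + (x - u k) = 2%:C *: (x - (2^-1 *: u j + 2^-1 *: u k)).
    rewrite -scalerDr scalerBr scalerA.
    rewrite (_ : 2%:C * 2^-1 = 1) ?scale1r; last first.
      by rewrite -[2%:C]/(real_complex R 2) rmorph_nat divff // pnatr_eq0.
    rewrite -[2%:C]/(real_complex R 2) rmorph_nat scaler_nat mulr2n.
    by rewrite addrACA opprD.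
  have := dS _ (MP 2^-1 _ _ (uP j).1 (MP 2^-1 _ _ (uP k).1 M0)).
  rewrite addr0 rnormZr // exprMn rnormN => d1.
  have [_ d2] := uP j; have [_ d3] := uP k.
  exact: arith d1 d2 d3.
have [l lP] : exists l, forall e : R, 0 < e ->
    exists N, forall k, (N <= k)%N -> rnorm (l - u k) < e.
  apply: cauchy_rnorm_cvg => e e0.
  have e4 : 0 < e ^+ 2 / 4 by rewrite divr_gt0 ?exprn_gt0.
  have [N NP] := exists_natSinv_lt e4; exists N => j k Nj Nk.
  rewrite -(ltr_pXn2r (n := 2)) // ?nnegrE ?rnorm_ge0 ?ltW //.
  exact: arith2 (uu j k) (NP _ Nj) (NP _ Nk).
have Ml : l \in subspace_pred M.
  apply: ((closedP_norm _).1 (subspace_closed (c:=M))) => e e0.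
  have [N NP] := lP _ e0; exists (u N); [exact: (uP N).1 | exact: NP].
exists (SubspaceElt Ml) => -[y My] /=.
have [->|y0] := eqVneq y 0; first by rewrite dotp0r.
have ny : 0 < rnorm y by exact: rnorm_gt0.
(* Compare [u k] with [u k + t^-1 r y], which is in [M]: its distance to [x]
   is at least the infimum. *)
have arith3 (a d p t : R) : d <= a + t - 2 * t -> a < d + p -> t <= p.
  by move=> *; lra.
have uy k : rnorm (dotp (x - u k) y) ^+ 2 <= k.+1%:R^-1 * rnorm y ^+ 2.
  set r := dotp (x - u k) y; set t := rnorm y ^+ 2.
  have t0 : 0 < t by rewrite exprn_gt0.
  have := dS _ (MP (t^-1%:C * r) _ _ My (uP k).1).
  rewrite opprD addrCA addrC sqr_rnormB dotpZr -/r.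
  rewrite conjcM conjc_real -mulrA.
  rewrite (mulrC r^*%C) mulrJ -rmorphM /= rnormZ rnormM rnorm_real ger0_norm ?invr_ge0 ?(ltW t0) //.
  rewrite !exprMn -/t; have [_ d0] := uP k.
  have -> : t^-1 ^+ 2 * rnorm r ^+ 2 * t = t^-1 * rnorm r ^+ 2.
    by field; rewrite gt_eqF.
  move=> d1; move: (arith3 _ _ _ _ d1 d0); by rewrite ler_pdivrMl // mulrC.
apply: rnorm_small => e e0.
have ey : 0 < (e / (2 * rnorm y)) by rewrite divr_gt0 ?mulr_gt0.
have ey2 : 0 < (e / (2 * rnorm y)) ^+ 2 by rewrite exprn_gt0.
have [N NP] := lP _ ey; have [N' NP'] := exists_natSinv_lt ey2.
pose k := maxn N N'.
have -> : x - l = (x - u k) - (l - u k) by rewrite opprB addrA subrK.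
rewrite dotpBl (le_trans (rnormD _ _)) // rnormN [leRHS]splitr lerD //.
  rewrite -(ler_pXn2r (n := 2)) ?nnegrE ?rnorm_ge0 //; last by rewrite divr_ge0 // ltW.
  rewrite (le_trans (uy k)) //.
  have -> : e / 2 = (e / (2 * rnorm y)) * rnorm y by field; rewrite gt_eqF.
  by rewrite exprMn ler_wpM2r ?sqr_ge0 // ltW // NP' // leq_maxr.
rewrite (le_trans (cauchy_schwarz _ _)) //.
have -> : e / 2 = (e / (2 * rnorm y)) * rnorm y by field; rewrite gt_eqF.
by rewrite ler_wpM2r ?rnorm_ge0 // ltW // NP // leq_maxl.
Qed.

Lemma orth_projP (M : closedSubspace H) x (y : subspace_of M) :
  dotp (x - val (orth_proj M x)) (val y) = 0.
Proof. by move: y; exact: (xgetPex 0 (orth_proj_exists M x)). Qed.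

(** If [f] is not zero, let [p] be the component orthogonal to the kernel of a point outside it.
    Then [x - (f x / f p) *: p] lies in the kernel, so its product with [p] vanishes and [f x] can
    be read off from [dotp x p]. *)
Lemma riesz (f : H -> R[i]) (C : R) :
  (forall a x y, f (a *: x + y) = a * f x + f y) ->
  (forall x, rnorm (f x) <= C * rnorm x) ->
  exists z, forall x, f x = dotp x z.
Proof.
move=> fl fC.
have f0 : f 0 = 0.
  apply: rnorm0_eq0; apply/eqP.
  by rewrite eq_le rnorm_ge0 (le_trans (fC _)) // rnorm0 mulr0.
have fB a x y : f (x - a *: y) = f x - a * f y by rewrite addrC -scaleNr fl addrC mulNr.
pose P : {pred H} := fun x => f x == 0.
have Ps : submod_closed P.
  split; first by rewrite unfold_in f0.
  by move=> a x y; rewrite !unfold_in fl => /eqP-> /eqP->; rewrite mulr0 addr0.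
have Pc : closed [set` P].
  apply/closedP_norm => x xP; apply/eqP; apply: rnorm_small => e e0.
  have C1 : 0 < `|C| + 1 by rewrite ltr_wpDl.
  have [y /eqP Py xy] := xP (e / (`|C| + 1)) (divr_gt0 e0 C1).
  have -> : f x = f (x - 1 *: y) by rewrite fB Py mulr0 subr0.
  rewrite scale1r (le_trans (fC _)) //; rewrite ltr_pdivlMr // in xy.
  rewrite (le_trans _ (ltW xy)) // mulrC ler_wpM2l ?rnorm_ge0 //.
  by rewrite (le_trans (ler_norm _)) // lerDl.
pose M := ClosedSubspace Ps Pc.
have [fz|/existsNP[x0 fx0]] := pselect (forall x, f x = 0).
  by exists 0 => x; rewrite fz dotp0r.
have [m mP] := orth_proj_exists M x0.
set p := x0 - val m in mP.
have fp : f p != 0.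
  have /eqP fm : f (val m) == 0 by exact: (valP m).
  by rewrite /p -[val m]scale1r fB fm mulr0 subr0; apply/eqP.
have pp : (rnorm p ^+ 2)%:C != 0.
  rewrite -dotpxx; apply: contra fp => /eqP/dotpxx_eq0 ->.
  by rewrite f0.
exists (((f p)^*%C / (rnorm p ^+ 2)%:C) *: p) => x.
have Px : x - (f x / f p) *: p \in subspace_pred M.
  by rewrite unfold_in /= /P fB divfK // subrr.
have := mP (SubspaceElt Px); rewrite /= dotpBr dotpZr dotpxx => /eqP.
rewrite subr_eq0 => /eqP xp.
have xpE : dotp x p = (f x / f p) * (rnorm p ^+ 2)%:C.
  by rewrite dotpC xp conjcM conjcK conjc_real.
rewrite dotpZr xpE conjcM conjcK conjc_inv conjc_real.
by rewrite [X in _ * X]mulrC mulrA divfK // mulrC divfK.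
Qed.

End Projection.

Section Adjoint.
Context {R : realType} {H K : hilbertType R} {f : H -> K} (bf : bounded_op f).

Lemma adjointP x y : dotp (f x) y = dotp x (adjoint f y).
Proof.
suff : exists z, forall x, dotp (f x) y = dotp x z.
  by move=> /(xgetPex 0)/(_ x).
have [lf [C C0 fC]] := (bounded_opP f).1 bf.
apply: (@riesz _ _ (fun x => dotp (f x) y) (C * rnorm y)).
  by move=> a u v; rewrite lf dotpDl dotpZl.
move=> u; rewrite (le_trans (cauchy_schwarz _ _)) // mulrAC.
by rewrite ler_wpM2r ?rnorm_ge0.
Qed.

Lemma dotp_ext (x y : H) : (forall z, dotp z x = dotp z y) -> x = y.
Proof.
move=> xy; apply/eqP; rewrite -subr_eq0; apply/eqP/dotpxx_eq0.
by rewrite dotpBr xy subrr.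
Qed.

Lemma adjoint_unique y z : (forall x, dotp (f x) y = dotp x z) -> adjoint f y = z.
Proof. by move=> zP; apply: dotp_ext => x; rewrite -adjointP. Qed.

Lemma adjoint_bounded : bounded_op (adjoint f).
Proof.
have [lf [C C0 fC]] := (bounded_opP f).1 bf.
apply/bounded_opP; split.
  by move=> a x y; apply: adjoint_unique => z; rewrite dotpDr dotpZr dotpDr dotpZr !adjointP.
exists C => // y; set z := adjoint f y.
have [->|z0] := eqVneq z 0; first by rewrite rnorm0 mulr_ge0 // rnorm_ge0.
have nz : 0 < rnorm z by exact: rnorm_gt0.
rewrite -(ler_pM2l nz) -expr2.
have := cauchy_schwarz (f z) y; rewrite adjointP -/z dotpxx rnorm_real ger0_norm ?sqr_ge0 //.
move/le_trans; apply.
by rewrite mulrA ler_wpM2r ?rnorm_ge0 // mulrC.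
Qed.

End Adjoint.

(** * Extension of bounded operators by density *)

Section Extension.
Context {R : realType}.
Implicit Types H K : hilbertType R.

(** Density as an induction principle: a closed subspace that contains a total set is the whole
    space. *)
Lemma lin_span_total H (A : set H) (P : set H) :
  closed P -> (forall a x y, P x -> P y -> P (a *: x + y)) -> P 0 ->
  closure (lin_span A) = setT -> (forall x, A x -> P x) -> forall x, P x.
Proof.
move=> cP PD P0 totA AP x; apply: ((closedP_norm _).1 cP) => e e0.
have /closureP_norm/(_ _ e0)[y [k [c [v [Av ->]]]] xy] : closure (lin_span A) x by rewrite totA.
exists (\sum_j c j *: v j) => //.
elim/big_ind: _ => // [u w Pu Pw|j _].
  by rewrite -[u]scale1r; apply: PD.
by rewrite -[_ *: _]addr0; apply: PD => //; apply/AP.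
Qed.

Lemma closed_eq_bounded H K (f g : H -> K) :
  bounded_op f -> bounded_op g -> closed [set x | f x = g x].
Proof.
move=> /bounded_opP[lf [C C0 fC]] /bounded_opP[lg [D D0 gD]].
apply/closedP_norm => x xP /=; apply/eqP; rewrite -subr_eq0; apply/eqP.
apply: rnorm_small => e e0.
have CD : 0 < C + D + 1 by rewrite ltr_wpDl ?addr_ge0.
have [y /= fgy] := xP _ (divr_gt0 e0 CD); rewrite ltr_pdivlMr // => xy.
have -> : f x - g x = f (x - y) - g (x - y).
  by rewrite (linB lf) (linB lg) fgy opprB addrA subrK.
rewrite (le_trans (rnormD _ _)) // rnormN (le_trans (lerD (fC _) (gD _))) //.
rewrite -mulrDl (le_trans _ (ltW xy)) // mulrC ler_wpM2l ?rnorm_ge0 //.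
by rewrite lerDl.
Qed.

Lemma bounded_eq_total H K (A : set H) (f g : H -> K) :
  bounded_op f -> bounded_op g -> closure (lin_span A) = setT ->
  (forall x, A x -> f x = g x) -> f = g.
Proof.
move=> bf bg totA fg; apply/funext; apply: (lin_span_total _ _ _ totA fg).
- exact: closed_eq_bounded.
- by move=> a x y /= fx fy; rewrite bf.1 bg.1 fx fy.
- by rewrite /= (lin0 bf.1) (lin0 bg.1).
Qed.

(** [G] is the graph of a densely defined operator. Giving it as a relation spares a proof that the
    value is independent of how a vector is written as a combination: the bound, applied to a
    difference, makes the relation single-valued. [P] is the closure of the graph; completeness of
    [K] makes it total. *)
Lemma closed_graph_extension H K (G : H -> K -> Prop) (C : R) : 0 <= C ->
  (forall a x x' y y', G x y -> G x' y' -> G (a *: x + x') (a *: y + y')) ->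
  (forall x y, G x y -> rnorm y <= C * rnorm x) ->
  closure [set x | exists y, G x y] = setT ->
  exists f : H -> K, [/\ linear f, forall x, rnorm (f x) <= C * rnorm x &
    forall x y, G x y -> f x = y].
Proof.
move=> C0 GD GC totG.
have GB x x' y y' : G x y -> G x' y' -> G (x - x') (y - y').
  by move=> g g'; rewrite (addrC x) (addrC y) -(scaleN1r x') -(scaleN1r y'); apply: GD.
have dense x (e : R) : 0 < e -> exists x' y', G x' y' /\ rnorm (x - x') < e.
  move=> e0; have /closureP_norm/(_ _ e0)[x' [y' g] xx'] :
      closure [set x | exists y, G x y] x by rewrite totG.
  by exists x', y'.
pose P x y := forall e : R, 0 < e ->
  exists x' y', [/\ G x' y', rnorm (x - x') < e & rnorm (y - y') < e].
have PD a x x' y y' : P x y -> P x' y' -> P (a *: x + x') (a *: y + y').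
  move=> p p' e e0.
  have a0 : 0 < rnorm a + 1 by rewrite ltr_wpDl ?rnorm_ge0.
  have d0 : 0 < e / (rnorm a + 1) / 2 by rewrite !divr_gt0.
  have ad : rnorm a * (e / (rnorm a + 1) / 2) <= e / 2.
    have -> : e / 2 = (rnorm a + 1) * (e / (rnorm a + 1) / 2).
      by rewrite [RHS]mulrA (mulrC _ (e / _)) divfK ?gt_eqF.
    by rewrite ler_wpM2r ?lerDl // ltW.
  have e20 : 0 < e / 2 by rewrite divr_gt0.
  have [u [v [g ux vy]]] := p _ d0; have [u' [v' [g' ux' vy']]] := p' _ e20.
  exists (a *: u + u'), (a *: v + v'); split; first exact: GD.
    rewrite opprD addrACA -scalerBr (le_lt_trans (rnormD _ _)) // rnormZ.
    by rewrite [ltRHS]splitr ler_ltD // (le_trans (ler_wpM2l (rnorm_ge0 _) (ltW ux))).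
  rewrite opprD addrACA -scalerBr (le_lt_trans (rnormD _ _)) // rnormZ.
  by rewrite [ltRHS]splitr ler_ltD // (le_trans (ler_wpM2l (rnorm_ge0 _) (ltW vy))).
have PC x y : P x y -> rnorm y <= C * rnorm x.
  move=> p; apply/ler_addgt0Pl => e e0.
  have C1 : 0 < C + 1 by rewrite ltr_wpDl.
  have [u [v [g ux vy]]] := p _ (divr_gt0 e0 C1).
  rewrite ltr_pdivlMr // in ux; rewrite ltr_pdivlMr // in vy.
  have h1 : rnorm y <= rnorm (y - v) + rnorm v by rewrite -{1}(subrK v y) rnormD.
  have h2 : rnorm u <= rnorm (x - u) + rnorm x.
    by rewrite -{1}(subrK x u) (le_trans (rnormD _ _)) // -opprB rnormN.
  have h3 := GC _ _ g.
  have h4 : C * rnorm u <= C * (rnorm (x - u) + rnorm x) by rewrite ler_wpM2l.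
  have arith (a b c d f t : R) : a <= b + c -> c <= d -> d <= C * (f + t) ->
    b * (C + 1) < e -> f * (C + 1) < e -> 0 <= b -> 0 <= f -> a <= e + C * t.
    move=> ab cd dft bC fC b0 f0.
    have h : C * (f * (C + 1)) <= C * e by rewrite ler_wpM2l // ltW.
    (* After multiplication by [C + 1] the two terms are bounded by [e] and [C * e]. *)
    suff k : b + C * f <= e by lra.
    rewrite -(ler_pM2r C1); lra.
  exact: arith h1 h3 h4 vy ux (rnorm_ge0 _) (rnorm_ge0 _).
have GP x y : G x y -> P x y.
  by move=> g e e0; exists x, y; rewrite !subrr !rnorm0.
have Pex x : exists y, P x y.
  have /choice[u uP] (k : nat) : exists p : H * K, G p.1 p.2 /\ rnorm (x - p.1) < k.+1%:R^-1.
    have [|x' [y' [g xx']]] := dense x k.+1%:R^-1; first by rewrite invr_gt0.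
    by exists (x', y').
  have [l lP] : exists l, forall e : R, 0 < e ->
      exists N, forall k, (N <= k)%N -> rnorm (l - (u k).2) < e.
    apply: cauchy_rnorm_cvg => e e0.
    have C1 : 0 < (2 * C + 1) by rewrite ltr_wpDl // mulr_ge0.
    have [N NP] := exists_natSinv_lt (divr_gt0 e0 C1).
    exists N => j k Nj Nk.
    apply: (le_lt_trans (GC _ _ (GB _ _ _ _ (uP j).1 (uP k).1))).
    have d : rnorm ((u j).1 - (u k).1) <= 2 * (e / (2 * C + 1)).
      rewrite -(subrK x (u j).1) -addrA (le_trans (rnormD _ _)) // mulr2n mulrDl mul1r lerD //.
        by rewrite -opprB rnormN ltW // (lt_trans (uP j).2) // NP.
      by rewrite ltW // (lt_trans (uP k).2) // NP.
    rewrite (le_lt_trans (ler_wpM2l C0 d)) //.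
    rewrite !mulrA ltr_pdivrMr // mulrC ltr_pM2l //.
    by rewrite mulrC ltrDl.
  exists l => e e0; have [N NP] := lP _ e0; have [N' NP'] := exists_natSinv_lt e0.
  exists (u (maxn N N')).1, (u (maxn N N')).2; split; first exact: (uP _).1.
    by rewrite (lt_trans (uP _).2) // NP' // leq_maxr.
  by rewrite NP // leq_maxl.
have Puniq x y y' : P x y -> P x y' -> y = y'.
  move=> p p'; have := PC _ _ (PD (-1) _ _ _ _ p' p).
  rewrite !scaleN1r addNr rnorm0 mulr0 addrC => yy'.
  apply/eqP; rewrite -subr_eq0; apply/eqP/rnorm0_eq0/eqP.
  by rewrite eq_le yy' rnorm_ge0.
have [f fP] := choice Pex; exists f; split.
- by move=> a x y; apply: Puniq (fP _) _; apply: PD.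
- by move=> x; apply: PC.
- by move=> x y /GP; apply: Puniq.
Qed.

Lemma sum_regroup (V W : lmodType R[i]) (I : eqType) (F : I -> V -> W) (l : seq (I * V)) :
  (forall i, linear (F i)) ->
  \sum_(p <- l) F p.1 p.2 =
  \sum_(b <- undup (map fst l)) F b (\sum_(p <- l | p.1 == b) p.2).
Proof.
move=> lF; under [RHS]eq_bigr => b _ do rewrite (lin_sum (lF b)).
rewrite (exchange_big_dep predT) //=; apply: eq_big_seq => p pl.
rewrite -big_filter (_ : [seq i <- _ | p.1 == i] = [:: p.1]) ?big_seq1 //.
rewrite (eq_filter (a2 := pred1 p.1)) => [|i]; last by rewrite eq_sym.
by rewrite filter_pred1_uniq ?undup_uniq // mem_undup map_f.
Qed.

(* The regrouping of a finite combination by index reduces the boundedness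
   hypothesis to sums over distinct indices. *)
Lemma family_extension (V : lmodType R[i]) H K (I : eqType)
    (J : I -> V -> H) (G : I -> V -> K) (C : R) :
  0 <= C -> (forall i, linear (J i)) -> (forall i, linear (G i)) ->
  closure (lin_span [set z | exists i v, z = J i v]) = setT ->
  (forall (s : seq I) (x : I -> V), uniq s ->
    rnorm (\sum_(b <- s) G b (x b)) <= C * rnorm (\sum_(b <- s) J b (x b))) ->
  exists f : H -> K, [/\ bounded_op f, forall x, rnorm (f x) <= C * rnorm x &
    forall i v, f (J i v) = G i v].
Proof.
move=> C0 lJ lG totJ GC.
pose rel x y := exists l : seq (I * V),
  x = \sum_(p <- l) J p.1 p.2 /\ y = \sum_(p <- l) G p.1 p.2.
have relD a x x' y y' : rel x y -> rel x' y' -> rel (a *: x + x') (a *: y + y').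
  move=> [l [-> ->]] [l' [-> ->]].
  exists ([seq (p.1, a *: p.2) | p <- l] ++ l'); rewrite !big_cat !big_map /=.
  split; congr (_ + _); rewrite scaler_sumr; apply: eq_bigr => p _.
    by rewrite (linZ (lJ _)).
  by rewrite (linZ (lG _)).
have relC x y : rel x y -> rnorm y <= C * rnorm x.
  move=> [l [-> ->]]; rewrite !sum_regroup //.
  exact: (GC _ (fun b => \sum_(p <- l | p.1 == b) p.2) (undup_uniq _)).
have totrel : closure [set x | exists y, rel x y] = setT.
  rewrite -totJ; congr closure; apply/seteqP; split => x /=.
    move=> [_ [l [-> _]]]; exists (size l), (fun=> 1).
    exists (fun j => J (tnth (in_tuple l) j).1 (tnth (in_tuple l) j).2).
    split; first by move=> j; eexists; eexists.
    by rewrite big_tnth; apply: eq_bigr => j _; rewrite scale1r.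
  move=> [k [c [v [Jv ->]]]].
  have [i iP] := choice Jv; have [w wP] := choice iP.
  exists (\sum_j G (i j) (c j *: w j)), [seq (i j, c j *: w j) | j <- index_enum 'I_k].
  rewrite !big_map; split=> //; apply: eq_bigr => j _.
  by rewrite wP (linZ (lJ _)).
have [f [lf fC fG]] := closed_graph_extension C0 relD relC totrel.
exists f; split => //; first by apply/bounded_opP; split=> //; exists C.
by move=> i v; apply: fG; exists [:: (i, v)]; rewrite !big_seq1.
Qed.

End Extension.

(** * Orthogonal families and tensor products *)

Section OrthogonalFamilies.
Context {R : realType}.
Implicit Types H K : hilbertType R.

Lemma total_sub H (A B : set H) :
  A `<=` B -> closure (lin_span A) = setT -> closure (lin_span B) = setT.
Proof.
move=> AB totA; apply/seteqP; split=> // x _.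
have : closure (lin_span A) x by rewrite totA.
apply: closureS => _ [k [c [v [Av ->]]]].
by exists k, c, v; split=> // j; apply: AB.
Qed.

Lemma closure_lin_spanD H (A : set H) a x y :
  closure (lin_span A) x -> closure (lin_span A) y -> closure (lin_span A) (a *: x + y).
Proof.
move=> /closureP_norm cx /closureP_norm cy; apply/closureP_norm => e e0.
have a0 : 0 < rnorm a + 1 by rewrite ltr_wpDl ?rnorm_ge0.
have [u [k [c [v [Av uE]]]] xu] := cx _ (divr_gt0 (divr_gt0 e0 a0) (ltr0n _ 2)).
have [w [l [d [t [At wE]]]] yw] := cy _ (divr_gt0 e0 (ltr0n _ 2)).
exists (a *: u + w).
  pose cd (j : 'I_(k + l)) := match fintype.split j with inl i => a * c i | inr i => d i end.
  pose vt (j : 'I_(k + l)) := match fintype.split j with inl i => v i | inr i => t i end.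
  exists (k + l)%N, cd, vt; split; first by move=> j; rewrite /vt; case: fintype.split.
  rewrite big_split_ord uE wE scaler_sumr; congr (_ + _); apply: eq_bigr => i _.
    by rewrite /cd /vt -[lshift _ i]/(unsplit (inl i)) unsplitK scalerA.
  by rewrite /cd /vt -[rshift _ i]/(unsplit (inr i)) unsplitK.
rewrite opprD addrACA -scalerBr (le_lt_trans (rnormD _ _)) // rnormZ.
rewrite [ltRHS]splitr ler_ltD //.
have -> : e / 2 = (rnorm a + 1) * (e / (rnorm a + 1) / 2).
  by rewrite [RHS]mulrA (mulrC _ (e / _)) divfK ?gt_eqF.
by rewrite ler_pM ?rnorm_ge0 ?(ltW xu) // lerDl.
Qed.

Lemma closed_preimage_bounded H K (f : H -> K) (P : set K) :
  bounded_op f -> closed P -> closed (f @^-1` P).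
Proof.
move=> /bounded_opP[lf [C C0 fC]] /closedP_norm cP; apply/closedP_norm => x xP /=.
apply: cP => e e0; have C1 : 0 < C + 1 by rewrite ltr_wpDl.
have [y Py xy] := xP _ (divr_gt0 e0 C1); exists (f y) => //.
rewrite -(linB lf) (le_lt_trans (fC _)) //; rewrite ltr_pdivlMr // in xy.
by rewrite (le_lt_trans _ xy) // mulrC ler_wpM2l ?rnorm_ge0 // lerDl.
Qed.

(** * Mutually orthogonal copies of one space, and weighted shifts between them *)

Section Shift.
Context {V : lmodType R[i]} {H : hilbertType R} {I : eqType}.
Context {J : I -> V -> H} {q : V -> V -> R[i]}.
Hypothesis lJ : forall i, linear (J i).
Hypothesis oJ : forall a b x y, dotp (J a x) (J b y) = (a == b)%:R * q x y.
Hypothesis totJ : closure (lin_span [set z | exists i v, z = J i v]) = setT.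

Lemma family_isometry a b v : rnorm (J a v) = rnorm (J b v).
Proof.
have E : rnorm (J a v) ^+ 2 = rnorm (J b v) ^+ 2.
  by apply: complexI; rewrite -!dotpxx !oJ !eqxx.
apply/eqP; rewrite -(eqrXn2 (n := 2)) ?rnorm_ge0 //; exact/eqP.
Qed.

Lemma sqr_rnorm_family (s : seq I) (x : I -> V) : uniq s ->
  rnorm (\sum_(b <- s) J b (x b)) ^+ 2 = \sum_(b <- s) rnorm (J b (x b)) ^+ 2.
Proof.
by move=> us; apply: pythagoras => // i j ij; rewrite oJ (negbTE ij) mul0r.
Qed.

(** Injectivity of [phi] keeps the images orthogonal, so Pythagoras on both sides reduces the bound
    to single terms. The lemma serves twice: with [V] the scalars for the Fock space, and with [V]
    the second factor for the tensor product. *)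
Lemma weighted_shift (phi : I -> I) (mu : I -> R) (C : R) :
  injective phi -> (forall i, 0 <= mu i <= C) -> 0 <= C ->
  exists f : H -> H, [/\ bounded_op f, forall x, rnorm (f x) <= C * rnorm x &
    forall i v, f (J i v) = (mu i)%:C *: J (phi i) v].
Proof.
move=> phi_inj muC C0.
apply: (@family_extension R V H H I J (fun i v => (mu i)%:C *: J (phi i) v)) => //.
  by move=> i a x y; rewrite lJ scalerDr !scalerA mulrC.
move=> s x us; rewrite -(ler_pXn2r (n := 2)) ?nnegrE ?mulr_ge0 ?rnorm_ge0 //.
rewrite exprMn sqr_rnorm_family // pythagoras //; last first.
  by move=> i j ij; rewrite dotpZl dotpZr oJ (inj_eq phi_inj) (negbTE ij) mul0r !mulr0.
rewrite mulr_sumr; apply: ler_sum => i _; have /andP[m0 mC] := muC i.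
rewrite rnormZr // (family_isometry _ i) exprMn ler_wpM2r ?sqr_ge0 //.
by rewrite ler_pXn2r ?nnegrE.
Qed.

End Shift.

End OrthogonalFamilies.

Section Tensor.
Context {R : realType} {F H : hilbertType R} {FH : hilbertTensor F H}.
Implicit Types (x : F) (y : H).

Lemma rnorm_tensor x y : rnorm (tensor FH x y) = rnorm x * rnorm y.
Proof.
apply/eqP; rewrite -(eqrXn2 (n := 2)) ?mulr_ge0 ?rnorm_ge0 // exprMn; apply/eqP.
by apply: complexI; rewrite [RHS]rmorphM /= -!dotpxx tensor_dotp.
Qed.

Lemma bounded_tensorl y : bounded_op (fun x => tensor FH x y).
Proof.
apply/bounded_opP; split; first exact: tensor_linearl.
by exists (rnorm y); [exact: rnorm_ge0 | move=> x; rewrite rnorm_tensor mulrC].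
Qed.

(** Density is used twice: elementary tensors are total, and for fixed [y] the bounded map sending
    [x] to its tensor with [y] carries the density of the basis combinations over to them. *)
Lemma tensor_basis_total (I : eqType) (e : I -> F) :
  orthonormal_basis e ->
  closure (lin_span [set z | exists a y, z = tensor FH (e a) y]) = setT.
Proof.
move=> [_ tote]; set A := [set z | _]; apply/seteqP; split=> // z _.
have S0 : lin_span A 0.
  by exists 0%N, (fun=> 0), (fun=> 0); split=> [[]//|]; rewrite big_ord0.
have cA0 : closure (lin_span A) 0 by apply: subset_closure.
have cAD := @closure_lin_spanD R FH A.
move: z; apply: (lin_span_total _ _ _ (tensor_total FH)) => //.
  exact: closed_closure.
move=> _ [x [y ->]].
move: x; apply: (lin_span_total (P := fun x => closure (lin_span A) (tensor FH x y)) _ _ _ tote).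
- exact: (closed_preimage_bounded (bounded_tensorl y) (@closed_closure _ _)).
- by move=> a u v Pu Pv; rewrite (tensor_linearl FH y); apply: cAD.
- by rewrite (lin0 (tensor_linearl FH y)).
move=> _ [a _ <-]; apply: subset_closure.
exists 1%N, (fun=> 1), (fun=> tensor FH (e a) y); split; first by move=> _; exists a, y.
by rewrite big_ord1 scale1r.
Qed.

(** Two bounded solutions agree on the total set of elementary tensors, so the one picked by [xget]
    is [h]. *)
Lemma tensor_opP (f : F -> F) (g : H -> H) (h : FH -> FH) :
  bounded_op h -> (forall x y, h (tensor FH x y) = tensor FH (f x) (g y)) ->
  tensor_op FH f g = h.
Proof.
move=> bh hE.
have ex : exists h' : FH -> FH, bounded_op h' /\
    forall x y, h' (tensor FH x y) = tensor FH (f x) (g y) by exists h.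
have [bt tE] := xgetPex (fun=> 0) ex.
apply: (bounded_eq_total bt bh (tensor_total FH)) => _ [x [y ->]].
by rewrite hE; exact: tE.
Qed.

Lemma adjoint_tensor (f : F -> F) (h : FH -> FH) :
  bounded_op f -> bounded_op h -> (forall x y, h (tensor FH x y) = tensor FH (f x) y) ->
  forall x y, adjoint h (tensor FH x y) = tensor FH (adjoint f x) y.
Proof.
move=> bf bh hE x y; apply/eqP; rewrite -subr_eq0; apply/eqP.
apply: (dotp_inj_total (tensor_total FH)) => _ [x' [y' ->]].
rewrite dotpC dotpBr -(adjointP bh) hE !tensor_dotp (adjointP bf) subrr.
by rewrite conjc0.
Qed.

End Tensor.

(** * Weighted multi-shifts *)

Section BoundedAlgebra.
Context {R : realType}.
Implicit Types H K L : hilbertType R.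

Lemma bounded_id H : bounded_op (id : H -> H).
Proof. by apply/bounded_opP; split=> //; exists 1 => // x; rewrite mul1r. Qed.

Lemma bounded_zero H K : bounded_op (fun _ : H => 0 : K).
Proof.
apply/bounded_opP; split; first by move=> a x y; rewrite scaler0 addr0.
by exists 0 => // x; rewrite rnorm0 mul0r.
Qed.

Lemma bounded_comp H K L (g : K -> L) (f : H -> K) :
  bounded_op g -> bounded_op f -> bounded_op (g \o f).
Proof.
move=> /bounded_opP[lg [D D0 gD]] /bounded_opP[lf [C C0 fC]]; apply/bounded_opP.
split; first by move=> a x y /=; rewrite lf lg.
exists (D * C); first exact: mulr_ge0.
by move=> x /=; rewrite (le_trans (gD _)) // -mulrA ler_wpM2l.
Qed.

Lemma bounded_add H K (f g : H -> K) :
  bounded_op f -> bounded_op g -> bounded_op (fun x => f x + g x).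
Proof.
move=> /bounded_opP[lf [C C0 fC]] /bounded_opP[lg [D D0 gD]]; apply/bounded_opP.
split; first by move=> a x y /=; rewrite lf lg scalerDr addrACA.
exists (C + D); first exact: addr_ge0.
by move=> x; rewrite (le_trans (rnormD _ _)) // mulrDl lerD.
Qed.

Lemma bounded_scale H K (a : R[i]) (f : H -> K) :
  bounded_op f -> bounded_op (fun x => a *: f x).
Proof.
move=> /bounded_opP[lf [C C0 fC]]; apply/bounded_opP.
split; first by move=> b x y /=; rewrite lf scalerDr !scalerA mulrC.
exists (rnorm a * C); first by rewrite mulr_ge0 ?rnorm_ge0.
by move=> x; rewrite rnormZ -mulrA ler_wpM2l ?rnorm_ge0.
Qed.

Lemma bounded_sum H K (I : Type) (r : seq I) (P : pred I) (f : I -> H -> K) :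
  (forall i, bounded_op (f i)) -> bounded_op (fun x => \sum_(i <- r | P i) f i x).
Proof.
move=> bf; elim: r => [|i r IH].
  rewrite (_ : (fun x => _) = (fun _ : H => 0 : K)); first exact: bounded_zero.
  by apply/funext => x; rewrite big_nil.
have [Pi|Pi] := boolP (P i).
  rewrite (_ : (fun x => _) = (fun x => f i x + \sum_(j <- r | P j) f j x)).
    exact: bounded_add.
  by apply/funext => x; rewrite big_cons Pi.
rewrite (_ : (fun x => _) = (fun x => \sum_(j <- r | P j) f j x)) //.
by apply/funext => x; rewrite big_cons (negbTE Pi).
Qed.

Lemma bounded_word H n (T : 'I_n -> H -> H) (a : seq 'I_n) :
  (forall i, bounded_op (T i)) -> bounded_op (word_op T a).
Proof.
move=> bT; elim: a => [|i a IH] /=; [exact: bounded_id | exact: bounded_comp].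
Qed.

Lemma op_norm_le H K (f : H -> K) (C : R) : 0 <= C ->
  (forall x, rnorm (f x) <= C * rnorm x) -> op_norm f <= C.
Proof.
move=> C0 fC; apply: ge_sup.
  by exists (rnorm (f 0)), 0 => //=; rewrite normr0.
move=> _ [x /= x1 <-]; rewrite -[leLHS]/(rnorm (f x)) (le_trans (fC x)) //.
by rewrite ler_piMr //; move: x1; rewrite normE lecR.
Qed.

Section OpNorm.
Context {H K : hilbertType R} {f : H -> K} (bf : bounded_op f).

Let ub : has_ubound [set rnorm (f x) | x in [set x : H | `|x| <= 1]].
Proof.
have [lf [C C0 fC]] := (bounded_opP f).1 bf; exists C => _ [x /= x1 <-].
rewrite (le_trans (fC x)) // ler_piMr //; move: x1; rewrite normE lecR //.
Qed.

Lemma op_norm_ge0 : 0 <= op_norm f.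
Proof.
apply: (le_trans (rnorm_ge0 (f 0))); apply: ub_le_sup ub _ _.
by exists 0 => //=; rewrite normr0.
Qed.

Lemma le_op_norm x : rnorm (f x) <= op_norm f * rnorm x.
Proof.
have [lf _] := bf.
have [->|x0] := eqVneq x 0; first by rewrite (lin0 lf) !rnorm0 mulr0.
have nx : 0 < rnorm x by exact: rnorm_gt0.
rewrite -ler_pdivrMr // mulrC -rnormZr ?invr_ge0 ?(ltW nx) // -(linZ lf).
apply: ub_le_sup ub _ _; exists ((rnorm x)^-1%:C *: x) => //=.
by rewrite normE rnormZr ?invr_ge0 ?(ltW nx) // mulVf ?gt_eqF // lecR.
Qed.

End OpNorm.

End BoundedAlgebra.

Section MultiShift.
Context {R : realType} {n : nat} {F : fockSpace R n}.
Local Notation e := (fock_basis F).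

Lemma fock_basis_total : closure (lin_span (range e)) = setT.
Proof. exact: (fock_basisP F).2. Qed.

Lemma fock_basis_ortho a b : dotp (e a) (e b) = (a == b)%:R.
Proof. exact: (fock_basisP F).1. Qed.

Lemma rnorm_fock_basis a : rnorm (e a) = 1.
Proof.
apply/eqP; rewrite -(eqrXn2 (n := 2)) ?rnorm_ge0 //; apply/eqP.
by apply: complexI; rewrite -dotpxx fock_basis_ortho eqxx expr1n.
Qed.

Lemma fock_weighted_shift (phi : seq 'I_n -> seq 'I_n) (mu : seq 'I_n -> R) (C : R) :
  injective phi -> (forall i, 0 <= mu i <= C) -> 0 <= C ->
  exists f : F -> F, [/\ bounded_op f, forall x, rnorm (f x) <= C * rnorm x &
    forall a, f (e a) = (mu a)%:C *: e (phi a)].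
Proof.
move=> phi_inj muC C0.
pose J a (c : R[i]^o) := c *: e a.
have lJ a : linear (J a) by move=> c x y; rewrite /J scalerDl scalerA.
have oJ a b (x y : R[i]^o) : dotp (J a x) (J b y) = (a == b)%:R * (x * y^*%C).
  by rewrite dotpZl dotpZr fock_basis_ortho; ring.
have totJ : closure (lin_span [set z | exists a c, z = J a c]) = setT.
  apply: total_sub fock_basis_total => _ [a _ <-].
  by exists a, 1; rewrite /J scale1r.
have [f [bf fC fE]] := weighted_shift lJ oJ totJ phi_inj muC C0.
exists f; split=> // a.
by have := fE a 1; rewrite /J !scale1r.
Qed.

Lemma fock_bounded_eq (f g : F -> F) : bounded_op f -> bounded_op g ->
  (forall a, f (e a) = g (e a)) -> f = g.
Proof.
move=> bf bg fg; apply: (bounded_eq_total bf bg fock_basis_total).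
by move=> _ [a _ <-].
Qed.

(** [f] agrees on the basis with the operator built by [fock_weighted_shift], and that operator
    comes with the bound. *)
Lemma fock_shift_bound (f : F -> F) phi mu (C : R) :
  injective phi -> (forall i, 0 <= mu i <= C) -> 0 <= C ->
  bounded_op f -> (forall a, f (e a) = (mu a)%:C *: e (phi a)) ->
  forall x, rnorm (f x) <= C * rnorm x.
Proof.
move=> phi_inj muC C0 bf fE.
have [g [bg gC gE]] := fock_weighted_shift phi_inj muC C0.
by rewrite (fock_bounded_eq bf bg) // => a; rewrite fE gE.
Qed.

Context {m : nat -> R}.
Hypothesis m_ge0 : forall k, 0 <= m k.
Hypothesis m_noninc : forall j k, (j <= k)%N -> m k <= m j.

Lemma multishift_exists : exists W : 'I_n -> F -> F,
  (forall i, bounded_op (W i)) /\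
  forall i a, W i (e a) = (m (size a).+1)%:C *: e (i :: a).
Proof.
have /choice[W WP] (i : 'I_n) : exists f : F -> F, bounded_op f /\
    forall a, f (e a) = (m (size a).+1)%:C *: e (i :: a).
  have [|||f [bf _ fE]] := @fock_weighted_shift (cons i) (fun a => m (size a).+1) (m 1).
  - by move=> a b [].
  - by move=> a; rewrite m_ge0 m_noninc.
  - exact: m_ge0.
  by exists f.
by exists W; split=> i; have [] := WP i.
Qed.

Context {W : 'I_n -> F -> F}.
Hypothesis bW : forall i, bounded_op (W i).
Hypothesis WE : forall i a, W i (e a) = (m (size a).+1)%:C *: e (i :: a).

Lemma multishift_weighted : weighted_left_multishift W.
Proof.
split=> //; exists (fun b => m (size b)); split.
- by move=> b _; exact: m_ge0.
- by move=> i; exists (m 0) => _ [a _ <-]; exact: m_noninc.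
- by move=> i a; rewrite WE.
Qed.

Lemma multishift_word a b :
  word_op W a (e b) = (\prod_(j < size a) m (size b + j).+1)%:C *: e (a ++ b).
Proof.
elim: a => [|i a IH]; first by rewrite big_ord0 scale1r.
rewrite /= -[LHS]/(W i (word_op W a (e b))) IH (linZ (bW i).1) WE scalerA.
by rewrite big_ord_recr rmorphM /= size_cat addnC.
Qed.

(** The adjoint strips the prefix [a] and returns the weight that [word_op W a] attaches when adding
    it. The test also fails for words shorter than [k], since [a] has length exactly [k]. *)
Lemma multishift_word_adjoint k (a : k.-tuple 'I_n) b :
  adjoint (word_op W a) (e b) =
  if take k b == a
  then (\prod_(j < k) m (size (drop k b) + j).+1)%:C *: e (drop k b) else 0.
Proof.
have bA := bounded_word a bW.
apply/eqP; rewrite -subr_eq0; apply/eqP.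
apply: (dotp_inj_total fock_basis_total) => _ [c _ <-].
rewrite dotpC dotpBr -adjointP // multishift_word size_tuple dotpZl fock_basis_ortho.
have [/eqP ba|ab] := ifP.
  rewrite dotpZr fock_basis_ortho conjc_real.
  rewrite -[b in _ == b](cat_take_drop k) ba eqseq_cat // eqxx /=.
  by case: eqP => [->|_]; rewrite ?mulr1 ?mulr0 subrr conjc0.
have -> : (a ++ c == b) = false.
  by apply: contraFF ab => /eqP <-; rewrite -{1}(size_tuple a) take_size_cat.
by rewrite dotp0r subr0 mulr0 conjc0.
Qed.

(** The operator is diagonal: on [e b] only the prefix of [b] of length [k] contributes, with
    eigenvalue [w b ^+ 2]. As the weights do not increase with the length, the largest eigenvalue
    occurs at length [k]. *)
Lemma multishift_square_le k x :
  rnorm (\sum_(a : k.-tuple 'I_n) word_op W a (adjoint (word_op W a) x)) <=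
  (\prod_(j < k) m j.+1) ^+ 2 * rnorm x.
Proof.
pose w (b : seq 'I_n) := \prod_(j < k) m (size (drop k b) + j).+1.
pose f x := \sum_(a : k.-tuple 'I_n) word_op W a (adjoint (word_op W a) x).
have w0 b : 0 <= w b by apply: prodr_ge0.
apply: (@fock_shift_bound f id (fun b => if (k <= size b)%N then w b ^+ 2 else 0)) => //.
- move=> b; case: ifP => _; last by rewrite lexx exprn_ge0 // prodr_ge0.
  rewrite exprn_ge0 //= ler_pXn2r ?nnegrE ?prodr_ge0 //.
  by apply: ler_prod => j _; rewrite m_ge0 m_noninc // ltnS leq_addl.
- by rewrite exprn_ge0 // prodr_ge0.
- apply: bounded_sum => a; apply: (bounded_comp (bounded_word a bW)).
  exact: adjoint_bounded (bounded_word a bW).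
move=> b; rewrite /f; case: ifP => kb.
  have tb : size (take k b) == k by rewrite size_takel.
  rewrite (bigD1 (Tuple tb)) //= big1 ?addr0 => [|a ab].
    rewrite (multishift_word_adjoint (Tuple tb)) eqxx (linZ (bounded_word _ bW).1).
    by rewrite multishift_word cat_take_drop scalerA (eqP tb) rmorphXn /= expr2.
  rewrite multishift_word_adjoint; case: eqP => [E|_]; last exact: (lin0 (bounded_word _ bW).1).
  by case/eqP: ab; apply: val_inj; rewrite /= E.
rewrite scale0r big1 // => a _; rewrite multishift_word_adjoint.
case: eqP => [E|_]; last exact: (lin0 (bounded_word _ bW).1).
by have := congr1 size E; rewrite size_tuple size_take_min => /minn_idPl; rewrite kb.
Qed.

(** The spectral sequence is at most the geometric mean of the first [k] weights, hence at most
    their arithmetic mean, which tends to 0 by the Cesaro theorem. *)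
Lemma multishift_quasi_nilpotent : m @ \oo --> 0 -> quasi_nilpotent W.
Proof.
move=> m0; rewrite /quasi_nilpotent /joint_spectral_radius_is.
(* The shift skips [k = 0], where the exponent is [0^-1 = 0], and matches the [k.+1] terms averaged
   by [arithmetic_mean]. *)
rewrite -(cvg_shiftS (joint_spectral_seq W)).
have mS0 : (fun k => m k.+1) @ \oo --> 0 by rewrite (cvg_shiftS m).
apply: squeeze_cvgr (cvg_cst 0) (cesaro mS0).
apply: nearW => k; apply/andP; split; first exact: powR_ge0.
rewrite /= /joint_spectral_seq.
set D := op_norm _.
have lam0 : 0 <= \prod_(j < k.+1) m j.+1 by exact: prodr_ge0.
have Dle : D <= (\prod_(j < k.+1) m j.+1) ^+ 2.
  by apply: op_norm_le; [exact: sqr_ge0 | exact: multishift_square_le].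
have D0 : 0 <= D.
  apply: op_norm_ge0; apply: bounded_sum => a; apply: (bounded_comp (bounded_word a bW)).
  exact: adjoint_bounded (bounded_word a bW).
have mu0 : 0 <= arithmetic_mean (fun k => m k.+1) k.
  by rewrite /arithmetic_mean /= mulr_ge0 // ?invr_ge0 // sumr_ge0.
have AGM : \prod_(j < k.+1) m j.+1 <= (arithmetic_mean (fun k => m k.+1) k) ^+ k.+1.
  have := (@leif_AGM R 'I_k.+1 predT (fun j => m j.+1) (fun j _ => m_ge0 j.+1)).1.
  by rewrite cardT size_enum_ord /arithmetic_mean /= mulrC /series /= big_mkord.
rewrite (le_trans (ge0_ler_powR _ _ _ Dle)) ?nnegrE ?sqr_ge0 ?invr_ge0 //.
have := ler_pXn2r (isT : (0 < 2)%N) lam0 (exprn_ge0 k.+1 mu0).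
rewrite AGM => sq.
rewrite (le_trans (ge0_ler_powR _ _ _ sq)) ?nnegrE ?exprn_ge0 ?invr_ge0 //.
rewrite -exprM -powR_mulrn // -powRrM mulnC divff ?powRr1 //.
Qed.

End MultiShift.

(** * Compactness of weighted multi-shifts *)

Section UltrafilterLimits.
Context {R : realType} {T : Type} {G : set_system T} (UG : UltraFilter G).

(** The image filter has a cluster point in a compact segment, and a cluster point of an ultrafilter
    is a limit: otherwise the complement of a neighbourhood would belong to the filter. *)
Lemma ultra_bounded_real (r : T -> R) (C : R) : G [set x | `|r x| <= C] ->
  exists p, forall e : R, 0 < e -> G [set x | `|p - r x| < e].
Proof.
move=> GC; have PG := @ultra_proper _ _ UG.
have : compact `[- C, C]%classic by exact: segment_compact.
move=> /(_ (fmap r G) (fmap_proper_filter r PG)) []; last move=> p [_ pc].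
  rewrite -[fmap r G _]/(G (r @^-1` [set` `[- C, C]])).
  by apply: filterS GC => x /=; rewrite in_itv /= ler_norml.
exists p => e e0.
have [//|nG] := in_ultra_setVsetC [set x | `|p - r x| < e] UG.
have imG : G (r @^-1` (r @` (~` [set x | `|p - r x| < e]))).
  by apply: filterS nG => x xA; exists x.
have [_ [[x xe <-] pe]] := pc _ _ imG (nbhsx_ballx p e e0).
by move: pe; rewrite -ball_normE.
Qed.

Lemma ultra_bounded_complex (z : T -> R[i]) (C : R) : G [set x | rnorm (z x) <= C] ->
  exists p, forall e : R, 0 < e -> G [set x | rnorm (p - z x) < e].
Proof.
move=> GC; have PG := @ultra_proper _ _ UG.
have nRe (w : R[i]) : `|complex.Re w| <= rnorm w by rewrite -lecR -normE normc_ge_Re.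
have norm_i : rnorm ('i%C : R[i]) = 1.
  by rewrite /rnorm normc_def /= expr0n expr1n add0r sqrtr1.
have nIm (w : R[i]) : `|complex.Im w| <= rnorm w.
  have -> : complex.Im w = complex.Re (w * - 'i%C).
    by rewrite mulrN raddfN /= ReiNIm opprK.
  by rewrite (le_trans (nRe _)) // rnormM rnormN norm_i mulr1.
have [|p pP] := @ultra_bounded_real (fun x => complex.Re (z x)) C.
  by apply: filterS GC => x /=; exact: le_trans.
have [|q qP] := @ultra_bounded_real (fun x => complex.Im (z x)) C.
  by apply: filterS GC => x /=; exact: le_trans.
exists (p%:C + 'i%C * q%:C) => e e0.
have e20 : 0 < e / 2 by rewrite divr_gt0.
apply: filterS (filterI (pP _ e20) (qP _ e20)) => x [/= px qx].
rewrite [z x]complexE opprD addrACA -mulrBr -!rmorphB /=.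
rewrite (le_lt_trans (rnormD _ _)) // rnormM !rnorm_real [ltRHS]splitr ltrD //.
by rewrite norm_i mul1r.
Qed.

End UltrafilterLimits.

Section MultiShiftCompact.
Context {R : realType} {n : nat} {F : fockSpace R n} {m : nat -> R}.
Hypothesis m_ge0 : forall k, 0 <= m k.
Hypothesis m_noninc : forall j k, (j <= k)%N -> m k <= m j.
Hypothesis m_cvg0 : m @ \oo --> 0.
Local Notation e := (fock_basis F).

(** The orthogonal projection onto the span of the words of length at most [k], of which there are
    finitely many. *)
Definition fock_truncation k (x : F) : F :=
  \sum_(a : k.-bseq 'I_n) dotp x (e a) *: e a.

Lemma bounded_fock_truncation k : bounded_op (fock_truncation k).
Proof.
apply: bounded_sum => a; apply/bounded_opP; split.
  by move=> c x y; rewrite dotpDl dotpZl scalerDl scalerA.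
exists 1 => // x; rewrite rnormZ rnorm_fock_basis mulr1 mul1r.
by rewrite (le_trans (cauchy_schwarz _ _)) // rnorm_fock_basis mulr1.
Qed.

Lemma fock_truncation_basis k b :
  fock_truncation k (e b) = if (size b <= k)%N then e b else 0.
Proof.
rewrite /fock_truncation; case: ifP => bk.
  rewrite (bigD1 (Bseq bk)) //= fock_basis_ortho eqxx scale1r big1 ?addr0 // => a ab.
  rewrite fock_basis_ortho (_ : b == a = false) ?scale0r //.
  by apply: contraNF ab => /eqP ba; apply/eqP/val_inj.
rewrite big1 // => a _; rewrite fock_basis_ortho (_ : b == a = false) ?scale0r //.
by apply: contraFF bk => /eqP ->; exact: size_bseq.
Qed.

Lemma bounded_fock_tail k : bounded_op (fun x => x - fock_truncation k x).
Proof.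
have := bounded_add (bounded_id F) (bounded_scale (-1) (bounded_fock_truncation k)).
by congr bounded_op; apply/funext => x; rewrite scaleN1r.
Qed.

(* A Hilbert cube, which contains the image of the unit ball under each
   component of the multi-shift when [C = m 1]. *)
Definition fock_cube (C : R) : set F :=
  [set y | rnorm y <= C /\ forall k, rnorm (y - fock_truncation k y) <= m k].

Lemma closed_rnorm_le (H K : hilbertType R) (f : H -> K) (C : R) :
  bounded_op f -> closed [set x | rnorm (f x) <= C].
Proof.
move=> /bounded_opP[lf [D D0 fD]]; apply/closedP_norm => x xP /=.
apply/ler_addgt0Pl => d d0; have D1 : 0 < D + 1 by rewrite ltr_wpDl.
have [y /= yC xy] := xP _ (divr_gt0 d0 D1); rewrite ltr_pdivlMr // in xy.
rewrite -(subrK y x) (linD lf) (le_trans (rnormD _ _)) // lerD //.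
rewrite (le_trans (fD _)) // (le_trans _ (ltW xy)) // mulrC ler_wpM2l ?rnorm_ge0 //.
by rewrite lerDl.
Qed.

Lemma closed_fock_cube C : closed (fock_cube C).
Proof.
have -> : fock_cube C = [set x | rnorm x <= C] `&`
    \bigcap_k [set x | rnorm (x - fock_truncation k x) <= m k].
  by apply/seteqP; split=> [x [xC xm]|x [xC xm]]; split=> // k *; exact: xm.
apply: closedI; first exact: closed_rnorm_le (bounded_id F).
by apply: closed_bigI => k _; apply: closed_rnorm_le (bounded_fock_tail k).
Qed.

(** Along an ultrafilter each of the finitely many coordinates of length at most [k] converges,
    while the tails are uniformly below [m k]; hence the ultrafilter is Cauchy. *)
Lemma compact_fock_cube C : compact (fock_cube C).
Proof.
rewrite compact_ultra => G UG GC; have PG := @ultra_proper _ _ UG.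
have : cvg G.
  apply: cauchy_cvg; apply: (cauchyP G).2 => eps eps0.
  have epsE : eps = (complex.Re eps)%:C by rewrite RRe_real // realE ltW.
  rewrite epsE ltcR in eps0; move: (complex.Re eps) epsE eps0 => d -> d0 {eps}.
  have d20 : 0 < d / 2 by rewrite divr_gt0.
  have [k mk] : exists k, m k < d / 2.
    move/cvgrPdist_lt: m_cvg0 => /(_ _ d20)[k _ kP]; exists k.
    by have := kP k (leqnn k); rewrite /= sub0r normrN ger0_norm.
  have /choice[p pP] (a : k.-bseq 'I_n) : exists p, forall r : R, 0 < r ->
      G [set y | rnorm (p - dotp y (e a)) < r].
    apply: (@ultra_bounded_complex _ _ _ UG (fun y => dotp y (e a)) C).
    apply: filterS GC => y [yC _] /=; rewrite (le_trans (cauchy_schwarz _ _)) //.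
    by rewrite rnorm_fock_basis mulr1.
  set N := #|{: k.-bseq 'I_n}|.
  (* The [N] coordinate errors add up to at most [d / 2]; the other half of [d] is for the tail. The
     successor keeps the divisor visibly positive. *)
  have dN : 0 < d / 2 / N.+1%:R by rewrite divr_gt0.
  exists (\sum_a p a *: e a).
  have Gp : G [set y | forall a : k.-bseq 'I_n, rnorm (p a - dotp y (e a)) < d / 2 / N.+1%:R].
    by apply: filter_forall => a; exact: pP.
  apply: (filterS _ (filterI GC Gp)) => y [[_ yk] yp].
  rewrite -ball_normE /ball_ /= normE ltcR.
  have -> : \sum_a p a *: e a - y = (\sum_a (p a - dotp y (e a)) *: e a) -
      (y - fock_truncation k y).
    under [X in _ = X - _]eq_bigr => a _ do rewrite scalerBl.
    by rewrite sumrB opprB addrA subrK.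
  rewrite (le_lt_trans (rnormD _ _)) // rnormN [ltRHS]splitr ler_ltD //; last first.
    exact: le_lt_trans (yk k) mk.
  rewrite (le_trans (rnorm_sum _ _ _)) //.
  have : \sum_(a : k.-bseq 'I_n) rnorm ((p a - dotp y (e a)) *: e a) <=
      \sum_(a : k.-bseq 'I_n) d / 2 / N.+1%:R.
    by apply: ler_sum => a _; rewrite rnormZ rnorm_fock_basis mulr1 ltW // yp.
  move/le_trans; apply; rewrite sumr_const -/N -[_ *+ _]mulr_natr.
  by rewrite mulrAC ler_pdivrMr // ler_pM2l // ler_nat.
move=> /cvg_ex[l Gl]; exists l; split=> //.
apply: (@closed_cvg _ _ G _ id (fock_cube C) _ _ l) => //; exact: closed_fock_cube.
Qed.

Context {W : 'I_n -> F -> F}.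
Hypothesis bW : forall i, bounded_op (W i).
Hypothesis WE : forall i a, W i (e a) = (m (size a).+1)%:C *: e (i :: a).

Lemma multishift_compact i : compact_op (W i).
Proof.
split=> //; apply: (precompact_subset (B := fock_cube (m 1))); last first.
  by rewrite (precompact_closed (@closed_fock_cube _)); exact: compact_fock_cube.
have cons_inj : injective (cons i) by move=> a b [].
move=> _ [x /= x1 <-]; rewrite normE lecR in x1.
split=> [|k].
  have := fock_shift_bound cons_inj (fun a => _) (m_ge0 1) (bW i) (WE i) x.
  have mb (a : seq 'I_n) : 0 <= m (size a).+1 <= m 1 by rewrite m_ge0 m_noninc.
  by move=> /(_ mb)/le_trans; apply; rewrite ler_piMr.
(* [W i] lengthens a word by one letter, so the tail after [W i] vanishes on [e a] exactly for
   [size a < k] and is itself a weighted shift, with weights at most [m k]. *)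
pose mu (a : seq 'I_n) := if (size a < k)%N then 0 else m (size a).+1.
have mub a : 0 <= mu a <= m k.
  rewrite /mu; case: ltnP => ak; first by rewrite lexx m_ge0.
  by rewrite m_ge0 m_noninc // ltnW.
have bf := bounded_comp (bounded_fock_tail k) (bW i).
have fE a : ((fun x => x - fock_truncation k x) \o W i) (e a) = (mu a)%:C *: e (i :: a).
  rewrite /= WE (linZ (bounded_fock_truncation k).1) -scalerBr fock_truncation_basis /= /mu.
  by case: ifP => _; rewrite ?subrr ?subr0 ?scaler0 ?scale0r.
have /= /le_trans := fock_shift_bound cons_inj mub (m_ge0 k) bf fE x.
by apply; rewrite ler_piMr.
Qed.

End MultiShiftCompact.

(** * The intertwining operator *)

Lemma nonincreasing_majorant (R : realType) (r : nat -> R) :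
  (forall k, 0 <= r k) -> r @ \oo --> 0 ->
  exists m : nat -> R, [/\ forall k, 0 < m k,
    forall j k, (j <= k)%N -> m k <= m j, m @ \oo --> 0 & forall k, 2 * r k <= m k].
Proof.
move=> r0 rl.
have ubr : has_ubound (range r).
  have [C CP] := cvg_has_ub (cvgP _ rl); exists C => _ [k _ <-].
  by rewrite (le_trans (ler_norm _)) // CP //; exists k.
have ubs k : has_ubound (sdrop r k).
  by case: ubr => C CP; exists C => _ [j _ <-]; apply: CP; exists j.
have rs k : r k <= sups r k by apply: ub_le_sup (ubs k) _ _; exists k => /=.
(* The supremum of the tail gives monotonicity and domination; the harmonic term gives strict
   positivity. *)
exists (fun k => 2 * sups r k + k.+1%:R^-1); split.
- by move=> k; rewrite ltr_wpDl ?invr_gt0 // mulr_ge0 // (le_trans (r0 k)).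
- move=> j k jk; rewrite lerD //; first by rewrite ler_pM2l // nonincreasing_sups.
  by rewrite lef_pV2 ?posrE // ler_nat.
- rewrite -[X in _ --> X](addr0 0) -[X in _ --> X + _](mulr0 2).
  apply: cvgD; last exact: cvg_harmonic.
  by apply: cvgMr; exact: cvg_sups rl.
by move=> k; rewrite (le_trans _ (ler_wpDr _ (lexx _))) ?invr_ge0 // ler_pM2l.
Qed.

(** * The row of all [T_a] with [a] of a fixed length *)

Section RowOperators.
Context {R : realType} {n : nat} {H : hilbertType R} {T : 'I_n -> H -> H}.
Hypothesis bT : forall i, bounded_op (T i).

Lemma bounded_word_square k :
  bounded_op (fun x => \sum_(a : k.-tuple 'I_n) word_op T a (adjoint (word_op T a) x)).
Proof.
apply: bounded_sum => a; apply: (bounded_comp (bounded_word a bT)).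
exact: adjoint_bounded (bounded_word a bT).
Qed.

Lemma sum_uniq_tuple (V : zmodType) (k : nat) (s : seq (seq 'I_n)) (f : seq 'I_n -> V) :
  uniq s -> all (fun b => size b == k) s ->
  \sum_(b <- s) f b = \sum_(a : k.-tuple 'I_n | tval a \in s) f a.
Proof.
move=> us ss; rewrite -[RHS]big_filter -(big_map (@tval k 'I_n) predT f).
apply: perm_big; apply: uniq_perm => //.
  by rewrite (map_inj_uniq val_inj) filter_uniq // index_enum_uniq.
move=> b; apply/idP/mapP => [bs|[a + ->]]; last by rewrite mem_filter => /andP[].
have bk : size b == k by exact: (allP ss).
by exists (Tuple bk) => //; rewrite mem_filter mem_index_enum /= bs.
Qed.

(** A row operator satisfies |R|^2 = |R R^*|. With z = R h and t = R^* z one has |z|^2 <= sum |h_b|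
    |t_b| and |t|^2 <= N |z|^2; the inequality 2 N |h_b| |t_b| <= N^2 |h_b|^2 + |t_b|^2 then absorbs
    one copy of N |z|^2. *)
Lemma row_bound (k : nat) (N : R) (s : seq (seq 'I_n)) (h : seq 'I_n -> H) :
  0 < N ->
  op_norm (fun x => \sum_(a : k.-tuple 'I_n) word_op T a (adjoint (word_op T a) x)) <= N ->
  uniq s -> all (fun b => size b == k) s ->
  rnorm (\sum_(b <- s) word_op T b (h b)) ^+ 2 <= N * \sum_(b <- s) rnorm (h b) ^+ 2.
Proof.
move=> N0 DN us ss; set z := \sum_(b <- s) _.
pose t b := adjoint (word_op T b) z.
have zE : rnorm z ^+ 2 <= \sum_(b <- s) rnorm (h b) * rnorm (t b).
  have -> : rnorm z ^+ 2 = complex.Re (dotp z z) by rewrite dotpxx.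
  rewrite {1}/z dotp_suml raddf_sum /=; apply: ler_sum => b _.
  rewrite (adjointP (bounded_word b bT)) (le_trans (rnorm_ge_Re _)) //.
  exact: cauchy_schwarz.
have tN : \sum_(b <- s) rnorm (t b) ^+ 2 <= N * rnorm z ^+ 2.
  rewrite (sum_uniq_tuple _ us ss).
  have : \sum_(a : k.-tuple 'I_n | tval a \in s) rnorm (t a) ^+ 2 <=
      \sum_(a : k.-tuple 'I_n) rnorm (t a) ^+ 2.
    rewrite [leRHS](bigID (fun a : k.-tuple 'I_n => tval a \in s)) /= lerDl.
    by rewrite sumr_ge0 // => a _; rewrite sqr_ge0.
  move/le_trans; apply.
  pose D x := \sum_(a : k.-tuple 'I_n) word_op T a (adjoint (word_op T a) x).
  have -> : \sum_(a : k.-tuple 'I_n) rnorm (t a) ^+ 2 = complex.Re (dotp (D z) z).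
    rewrite dotp_suml raddf_sum /=; apply: eq_bigr => a _.
    by rewrite (adjointP (bounded_word a bT)) dotpxx.
  rewrite (le_trans (rnorm_ge_Re _)) // (le_trans (cauchy_schwarz _ _)) //.
  rewrite expr2 mulrA ler_wpM2r ?rnorm_ge0 //.
  rewrite (le_trans (le_op_norm (bounded_word_square k) _)) //.
  by rewrite ler_wpM2r ?rnorm_ge0.
have amgm : 2 * N * \sum_(b <- s) rnorm (h b) * rnorm (t b) <=
    N ^+ 2 * (\sum_(b <- s) rnorm (h b) ^+ 2) + \sum_(b <- s) rnorm (t b) ^+ 2.
  rewrite !mulr_sumr -big_split /=; apply: ler_sum => b _.
  have arith (x y : R) : 2 * N * (x * y) <= N ^+ 2 * x ^+ 2 + y ^+ 2.
    rewrite -subr_ge0 (_ : _ - _ = (N * x - y) ^+ 2) ?sqr_ge0 //; ring.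
  exact: arith.
have arith (Z X Y V : R) : Z <= Y -> V <= N * Z -> 2 * N * Y <= N ^+ 2 * X + V -> Z <= N * X.
  move=> ZY VN YX; rewrite -(ler_pM2l N0); have := ler_wpM2l (ltW N0) ZY.
  rewrite -mulrA in YX; rewrite mulrA -expr2 => NZY; lra.
exact: arith zE tN amgm.
Qed.

Lemma joint_spectral_seqK k : (0 < k)%N ->
  joint_spectral_seq T k ^+ (2 * k) =
  op_norm (fun x => \sum_(a : k.-tuple 'I_n) word_op T a (adjoint (word_op T a) x)).
Proof.
move=> k0; rewrite /joint_spectral_seq -powR_mulrn ?powR_ge0 // -powRrM mulVf ?powRr1 //.
  exact: op_norm_ge0 (bounded_word_square k).
by rewrite pnatr_eq0 muln_eq0 /= -lt0n.
Qed.

End RowOperators.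

Lemma sum_half_pow_le (R : realType) (M : nat) : \sum_(j < M) (2^-1 : R) ^+ j <= 2.
Proof.
suff -> : \sum_(j < M) (2^-1 : R) ^+ j = 2 - 2 * 2^-1 ^+ M.
  by rewrite gerBl mulr_ge0 // exprn_ge0 // invr_ge0.
elim: M => [|M IH]; first by rewrite big_ord0 expr0 mulr1 subrr.
by rewrite big_ord_recr /= IH exprS; field.
Qed.

Lemma orth_proj_unique (R : realType) (H : hilbertType R) (M : closedSubspace H)
    x (p : subspace_of M) :
  (forall y : subspace_of M, dotp (x - val p) (val y) = 0) -> orth_proj M x = p.
Proof.
move=> px; apply/eqP; rewrite -subr_eq0; apply/eqP/dotpxx_eq0.
set d := _ - _; rewrite -[LHS]/(dotp (val d) (val d)).
have dE : val d = (x - val p) - (x - val (orth_proj M x)).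
  by rewrite opprB addrC addrA subrK.
by rewrite {1}dE dotpBl px orth_projP subrr.
Qed.

Lemma val_subspace_linear (R : realType) (H : hilbertType R) (M : closedSubspace H)
    (a : R[i]) (x y : subspace_of M) : val (a *: x + y) = a *: val x + val y.
Proof. by rewrite linearP. Qed.

Lemma bounded_orth_proj (R : realType) (H : hilbertType R) (M : closedSubspace H) :
  bounded_op (orth_proj M).
Proof.
apply/bounded_opP; split.
  move=> a x y; apply: orth_proj_unique => z.
  have -> : a *: x + y - val (a *: orth_proj M x + orth_proj M y) =
      a *: (x - val (orth_proj M x)) + (y - val (orth_proj M y)).
    by rewrite val_subspace_linear opprD addrACA scalerBr.
  by rewrite dotpDl dotpZl !orth_projP mulr0 addr0.
exists 1 => // x; rewrite mul1r; set p := orth_proj M x.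
have [->|p0] := eqVneq p 0; first by rewrite rnorm0 rnorm_ge0.
have np : 0 < rnorm p by exact: rnorm_gt0.
rewrite -(ler_pM2r np) -expr2.
have /eqP := orth_projP x p; rewrite dotpBl subr_eq0 => /eqP xp.
have := cauchy_schwarz x (val p); rewrite xp.
by rewrite -/(dotp p p) dotpxx rnorm_real ger0_norm ?sqr_ge0.
Qed.

(** Existence of the tensor product of [W i] with the identity: it is built as a weighted shift on
    the copies of [H] indexed by words. *)
Lemma tensor_weighted_shift (R : realType) (n : nat) (H : hilbertType R)
    (F : fockSpace R n) (FH : hilbertTensor F H) (W : 'I_n -> F -> F) (m : nat -> R) :
  (forall k, 0 <= m k) -> (forall j k, (j <= k)%N -> m k <= m j) ->
  (forall i, bounded_op (W i)) ->
  (forall i a, W i (fock_basis F a) = (m (size a).+1)%:C *: fock_basis F (i :: a)) ->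
  forall i, exists S : FH -> FH, [/\ bounded_op S,
    forall x y, S (tensor FH x y) = tensor FH (W i x) y &
    forall a y, S (tensor FH (fock_basis F a) y) =
      (m (size a).+1)%:C *: tensor FH (fock_basis F (i :: a)) y].
Proof.
move=> m0 mn bW WE i.
pose J a y := tensor FH (fock_basis F a) y.
have lJ a : linear (J a) by exact: tensor_linearr.
have oJ a b (x y : H) : dotp (J a x) (J b y) = (a == b)%:R * dotp x y.
  by rewrite tensor_dotp fock_basis_ortho.
have totJ := tensor_basis_total (FH := FH) (fock_basisP F).
have cons_inj : injective (cons i) by move=> a b [].
have mb (a : seq 'I_n) : 0 <= m (size a).+1 <= m 1 by rewrite m0 mn.
have [S [bS _ SE]] := weighted_shift lJ oJ totJ cons_inj mb (m0 1).
exists S; split=> // x y.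
(* For fixed [y] both sides are bounded operators in [x], so agreement on the basis suffices. *)
have := bounded_eq_total (bounded_comp bS (bounded_tensorl (FH := FH) y))
  (bounded_comp (bounded_tensorl (FH := FH) y) (bW i)) (fock_basis_total (F := F)).
move=> -/(_ _)/(congr1 (fun f => f x)); apply=> _ [a _ <-] /=.
by rewrite -[LHS]/(S (J a y)) SE WE (linZ (tensor_linearl FH y)).
Qed.

(** * Boundedness of the intertwining operator *)

Section RowExtension.
Context {R : realType} {n : nat} {H : hilbertType R} {F : fockSpace R n}.
Context {FH : hilbertTensor F H} {T : 'I_n -> H -> H} {lam : nat -> R} {K : R}.
Hypothesis bT : forall i, bounded_op (T i).
Hypothesis lam_gt0 : forall k, 0 < lam k.
Hypothesis K_gt0 : 0 < K.
Hypothesis normT : forall k,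
  op_norm (fun x => \sum_(a : k.-tuple 'I_n) word_op T a (adjoint (word_op T a) x)) <=
  (K * 2^-1 ^+ k * lam k) ^+ 2.

(** A finite combination is cut by word length. The slice of length [j] costs [K * 2^-1 ^+ j] by
    [row_bound], so the geometric series yields the constant [K * 2]. *)
Lemma row_extension : exists L : FH -> H, bounded_op L /\
  forall a h, L (tensor FH (fock_basis F a) h) = ((lam (size a))^-1)%:C *: word_op T a h.
Proof.
pose J a y := tensor FH (fock_basis F a) y.
have lJ a : linear (J a) by exact: tensor_linearr.
have oJ a b (x y : H) : dotp (J a x) (J b y) = (a == b)%:R * dotp x y.
  by rewrite tensor_dotp fock_basis_ortho.
have nJ a h : rnorm (J a h) = rnorm h.
  by rewrite rnorm_tensor rnorm_fock_basis mul1r.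
have totJ := tensor_basis_total (FH := FH) (fock_basisP F).
pose G a h := ((lam (size a))^-1)%:C *: word_op T a h.
have lG a : linear (G a) by exact: (bounded_scale _ (bounded_word a bT)).1.
have K20 : 0 <= K * 2 by rewrite mulr_ge0 // ltW.
have [|L [bL _ LE]] := family_extension K20 lJ lG totJ; last by exists L.
move=> s x us; set u := \sum_(b <- s) J b (x b).
pose M := \max_(b <- s) size b.
have sM b : b \in s -> (size b <= M)%N.
  by move=> bs; rewrite /M (big_rem b) //= leq_maxl.
(* All lengths in [s] are at most [M], so [inord] merges no two of them. *)
rewrite (partition_big (fun b => inord (size b) : 'I_M.+1) predT) //=.
rewrite (le_trans (rnorm_sum _ _ _)) //.
have slice (j : 'I_M.+1) :
    rnorm (\sum_(b <- s | inord (size b) == j) G b (x b)) <= K * 2^-1 ^+ j * rnorm u.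
  rewrite -big_filter; set sj := seq.filter _ _.
  have usj : uniq sj by exact: filter_uniq.
  have ssj : all (fun b => size b == j) sj.
    apply/allP => b; rewrite mem_filter => /andP[/eqP <- bs].
    by rewrite inordK // ltnS sM.
  have -> : \sum_(b <- sj) G b (x b) = ((lam j)^-1)%:C *: \sum_(b <- sj) word_op T b (x b).
    rewrite scaler_sumr; apply: eq_big_seq => b bs.
    by rewrite /G (eqP (allP ssj _ bs)).
  rewrite rnormZr ?invr_ge0 ?(ltW (lam_gt0 _)) // ler_pdivrMl //.
  have c0 : 0 < K * 2^-1 ^+ j * lam j by rewrite !mulr_gt0 // exprn_gt0 // invr_gt0.
  have := row_bound bT (fun b => x b) (exprn_gt0 2 c0) (normT j) usj ssj.
  have su : \sum_(b <- sj) rnorm (x b) ^+ 2 <= rnorm u ^+ 2.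
    rewrite (sqr_rnorm_family oJ) // big_filter.
    under [leRHS]eq_bigr => b _ do rewrite nJ.
    rewrite [leRHS](bigID (fun b => inord (size b) == j)) /= lerDl.
    by rewrite sumr_ge0 // => b _; rewrite sqr_ge0.
  move=> /le_trans/(_ (ler_wpM2l (ltW (exprn_gt0 2 c0)) su)).
  rewrite -exprMn ler_pXn2r ?nnegrE ?rnorm_ge0 ?(mulr_ge0 (ltW c0)) ?rnorm_ge0 //.
  by move/le_trans; apply; rewrite [leRHS]mulrA (mulrC (lam j)).
rewrite (le_trans (ler_sum _ (fun j _ => slice j))) //.
rewrite -mulr_suml -mulr_sumr ler_wpM2r ?rnorm_ge0 // ler_pM2l //.
exact: sum_half_pow_le.
Qed.

End RowExtension.

Theorem theorem3p1 (R : realType) (n : nat) (n_ge1 : (1 <= n)%N)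
    (H : hilbertType R) (F : fockSpace R n) (FH : hilbertTensor F H)
    (T : 'I_n -> H -> H) (T_bounded : forall i, bounded_op (T i))
    (T_quasi_nilpotent : quasi_nilpotent T) :
  exists W : 'I_n -> F -> F,
    [/\ weighted_left_multishift W,
        quasi_nilpotent W,
        forall i, compact_op (W i)
      & exists M : closedSubspace FH,
          (forall i, invariant_subspace M (tensor_op FH (adjoint (W i)) id)) /\
          jointly_similar T
            (fun i => compression M (tensor_op FH (W i) id))].
Proof.
have r0 k : 0 <= joint_spectral_seq T k by exact: powR_ge0.
have [m [m0 mn ml mr]] := nonincreasing_majorant r0 T_quasi_nilpotent.
have mge0 k : 0 <= m k by exact: ltW.
have [W [bW WE]] := multishift_exists (F := F) mge0 mn.
exists W; split.
- exact (multishift_weighted mge0 mn bW WE).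
- exact (multishift_quasi_nilpotent mge0 mn bW WE ml).
- exact (multishift_compact mge0 mn ml bW WE).
have /choice[S SP] := tensor_weighted_shift FH mge0 mn bW WE.
have bS i : bounded_op (S i) by have [] := SP i.
pose lam k := \prod_(j < k) m j.+1.
have lam0 k : 0 < lam k by rewrite prodr_gt0.
pose D k x := \sum_(a : k.-tuple 'I_n) word_op T a (adjoint (word_op T a) x).
have D0 : 0 <= op_norm (D 0) by exact: op_norm_ge0 (bounded_word_square T_bounded 0).
(* The factor [1 + op_norm (D 0)] takes care of [k = 0], where the joint
   spectral sequence carries no information: its exponent is [0^-1 = 0]. *)
have K0 : 0 < 1 + op_norm (D 0) by rewrite ltr_pwDl.
have normT k : op_norm (D k) <= ((1 + op_norm (D 0)) * 2^-1 ^+ k * lam k) ^+ 2.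
  case: (posnP k) => [->|k0].
    rewrite /lam big_ord0 expr0 !mulr1.
    have arith (x : R) : 0 <= x -> x <= (1 + x) ^+ 2 by nra.
    exact: arith.
  rewrite -(joint_spectral_seqK T_bounded k0) mulnC exprM.
  have h0 : 0 <= 2^-1 ^+ k * lam k by rewrite mulr_ge0 ?exprn_ge0 ?invr_ge0 // ltW.
  rewrite -mulrA ler_pXn2r ?nnegrE ?exprn_ge0 ?(mulr_ge0 (ltW K0)) //.
  (* Both sides become products of [k] factors, compared one by one: twice the spectral term is at
     most [m k], hence at most [m j.+1] because [j < k]. *)
  apply: (@le_trans _ _ (2^-1 ^+ k * lam k)).
    rewrite (_ : 2^-1 ^+ k * lam k = \prod_(j < k) (2^-1 * m j.+1)); last first.
      by rewrite big_split /= prodr_const card_ord.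
    have -> : joint_spectral_seq T k ^+ k = \prod_(j < k) joint_spectral_seq T k.
      by rewrite prodr_const card_ord.
    apply: ler_prod => j _.
    by rewrite r0 /= ler_pdivlMl // (le_trans (mr k)) // mn.
  by rewrite ler_peMl // lerDl.
have [L [bL LE]] := @row_extension _ _ _ _ FH _ _ _ T_bounded lam0 K0 normT.
(* The weight [m (size a).+1] produced by the shift cancels the last factor of [lam (size a).+1]. *)
have LS i u : L (S i u) = T i (L u).
  have := bounded_eq_total (bounded_comp bL (bS i)) (bounded_comp (T_bounded i) bL)
    (tensor_basis_total (FH := FH) (fock_basisP F)).
  move=> -/(_ _)/(congr1 (fun f => f u)); apply=> _ [a [h ->]] /=.
  have [_ _ ->] := SP i; rewrite (linZ bL.1) !LE (linZ (T_bounded i).1) scalerA.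
  congr (_ *: _); rewrite -rmorphM /=; congr _%:C.
  by rewrite /lam big_ord_recr /= invfM mulrCA mulfV ?mulr1 // gt_eqF.
have Le h : L (tensor FH (fock_basis F [::]) h) = h.
  by rewrite LE /lam big_ord0 invr1 scale1r.
pose P : {pred FH} := fun z => `[< forall x, L x = 0 -> dotp x z = 0 >].
have PP z : reflect (forall x, L x = 0 -> dotp x z = 0) (z \in P) by exact: asboolP.
have Ps : submod_closed P.
  split; first by apply/PP => x _; rewrite dotp0r.
  by move=> a u v /PP Pu /PP Pv; apply/PP => x Lx; rewrite dotpDr dotpZr Pu // Pv // mulr0 addr0.
have Pc : closed [set` P].
  apply/closedP_norm => z zP; apply/PP => x Lx; apply: rnorm_small => d d0.
  have x1 : 0 < rnorm x + 1 by rewrite ltr_wpDl ?rnorm_ge0.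
  have [w /PP Pw zw] := zP _ (divr_gt0 d0 x1); rewrite ltr_pdivlMr // in zw.
  rewrite -(subrK w z) dotpDr Pw // addr0 (le_trans (cauchy_schwarz _ _)) //.
  by rewrite (le_trans _ (ltW zw)) // mulrC ler_wpM2l ?rnorm_ge0 // lerDl.
pose M := ClosedSubspace Ps Pc.
(* The range of [adjoint L] lies in [M], so what [orth_proj M] removes from [u] is orthogonal to
   every [adjoint L h] and is therefore killed by [L]. *)
have LP u : L (val (orth_proj M u)) = L u.
  apply/eqP; rewrite eq_sym -subr_eq0 -(linB bL.1); apply/eqP/dotp_ext => h.
  have Ph : adjoint L h \in P.
    by apply/PP => x Lx; rewrite -(adjointP bL) Lx dotp0l.
  have := orth_projP u (SubspaceElt (M := M) Ph).
  by rewrite /= -(adjointP bL) => uh; rewrite dotp0r dotpC uh conjc0.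
have SE i : tensor_op FH (W i) id = S i.
  by apply: tensor_opP => //; have [] := SP i.
have aSE i : tensor_op FH (adjoint (W i)) id = adjoint (S i).
  apply: tensor_opP; first exact: adjoint_bounded.
  by apply: adjoint_tensor => //; have [] := SP i.
exists M; split.
  move=> i z /PP Mz; apply/PP => x Lx; rewrite aSE -adjointP // Mz // LS Lx.
  exact: (lin0 (T_bounded i).1).
exists (fun h => orth_proj M (tensor FH (fock_basis F [::]) h)), (fun y => L (val y)).
split.
- have bt : bounded_op (tensor FH (fock_basis F [::])).
    apply/bounded_opP; split; first exact: tensor_linearr.
    by exists 1 => // h; rewrite rnorm_tensor rnorm_fock_basis.
  exact: bounded_comp (bounded_orth_proj M) bt.
- have bv : bounded_op (val : subspace_of M -> FH).
    apply/bounded_opP; split; first exact: val_subspace_linear.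
    by exists 1 => // y; rewrite mul1r.
  exact: bounded_comp bL bv.
- by move=> h; rewrite LP Le.
(* The difference [d] lies in [M] and in the kernel of [L], so it is orthogonal to itself. *)
- move=> y; apply/eqP; rewrite -subr_eq0; apply/eqP/dotpxx_eq0.
  set d := _ - _; have /PP := valP d; apply.
  by rewrite /d raddfB /= (linB bL.1) LP Le subrr.
(* [L] does not see the two projections, by [LP], so the intertwining [LS] passes to the
   compression. *)
- by move=> i h; rewrite /compression SE LP LS LP Le.
Qed.
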